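(* Let $X,Y\subset\mathbb{R}^d$ be finite point clouds in general position. Then for every dimension $k\ge0$, $$W_\infty\big(\mathrm{Dgm}^k_{\mathcal{DR}}(X),\ \mathrm{Dgm}^k_{\mathcal{DR}}(Y)\big)\le (c_{k+1}-1)\max\{\delta(X),\delta(Y)\}+2\,d_{GH}(X,Y),$$ where $c_m=\sqrt{2m/(m+1)}$, $\delta(\cdot)$ is the diameter and $d_{GH}$ is the Gromov–Hausdorff distance (for the Euclidean metric).
   Context: General position: no $d+1$ points on a common affine hyperplane and no $d+2$ on a common $(d-1)$-sphere, so that the Delaunay complex $\mathsf{DEL}(\cdot)$ is defined. $\delta(\sigma)=\max_{x,y\in\sigma}\|x-y\|_2$. Delaunay--Rips filtration: $\mathcal{DR}_r(X)=\{\sigma\in\mathsf{DEL}(X):\delta(\sigma)\le2r\}$, $r\ge0$. $\mathrm{Dgm}^k_{\mathcal{DR}}(X)$ is its $k$-dimensional persistence diagram (field coefficients), and $W_\infty$ is the bottleneck distance (infimum over bijections of diagrams augmented with diagonal points of the maximal $\ell^\infty$ cost, diagonal–diagonal pairs costing $0$). *)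

(* Defs.v *)
From HB Require Import structures.
From mathcomp Require Import all_boot all_order all_algebra.
From mathcomp Require Import all_classical all_reals ereal.
Set Implicit Arguments. Unset Strict Implicit. Unset Printing Implicit Defensive.
Import Order.TTheory GRing.Theory Num.Theory.
Local Open Scope ring_scope.

Section DR.
Variable R : realType.

Definition dotv (d : nat) (u v : 'rV[R]_d) : R := \sum_(l < d) u 0 l * v 0 l.
Definition edist (d : nat) (x y : 'rV[R]_d) : R := Num.sqrt (dotv (x - y) (x - y)).

(* A finite point cloud with n points, given as an injective family. *)
Variables (d n : nat) (X : 'I_n -> 'rV[R]_d).

Definition diam_of (s : {set 'I_n}) : R :=
  \big[Num.max/0]_(i in s) \big[Num.max/0]_(j in s) edist (X i) (X j).
Definition diam : R := diam_of [set: 'I_n].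

Definition general_position : Prop :=
  (forall S : {set 'I_n}, #|S| = d.+1 ->
     ~ exists (a : 'rV[R]_d) (b : R), a != 0 /\ forall i, i \in S -> dotv a (X i) = b) /\
  (forall S : {set 'I_n}, #|S| = d.+2 ->
     ~ exists (c : 'rV[R]_d) (rho : R), forall i, i \in S -> edist (X i) c = rho).

Definition delaunay (s : {set 'I_n}) : Prop :=
  (s != finset.set0) /\ exists (c : 'rV[R]_d) (rho : R),
    (forall i, i \in s -> edist (X i) c = rho) /\ (forall j, rho <= edist (X j) c).

Definition DR (r : R) (s : {set 'I_n}) : Prop := delaunay s /\ diam_of s <= 2 * r.

Variable F : fieldType.

Definition NS := #|{set 'I_n}|.

(* oriented boundary matrix: vertices of each simplex ordered by their index;
   row = simplex sigma, column = codimension-1 face tau (tau nonempty) *)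
Definition bdry : 'M[F]_NS :=
  \matrix_(i < NS, j < NS)
    let s := enum_val i in let t := enum_val j in
    if [&& t \subset s, #|s| == #|t|.+1 & 0 < #|t|]%N
    then \sum_(v in s :\: t) (-1) ^+ #|[set u in s | (u < v)%N]|
    else 0.

(* row space spanned by the k-simplices (k+1 vertices) of a complex K *)
Definition chains (K : {set 'I_n} -> Prop) (k : nat) : 'M[F]_NS :=
  \matrix_(i < NS, j < NS)
    (if (i == j) && `[< K (enum_val i) /\ #|enum_val i| = k.+1 >] then 1 else 0).

Definition cycles K k : 'M[F]_NS := (chains K k :&: kermx bdry)%MS.
Definition boundaries K k : 'M[F]_NS := (chains K k.+1 *m bdry)%MS.

(* persistent Betti number: rank of H_k(DR_s) -> H_k(DR_t) induced by inclusion *)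
Definition pbetti (k : nat) (s t : R) : nat :=
  (\rank (cycles (DR s) k) - \rank (cycles (DR s) k :&: boundaries (DR t) k)%MS)%N.

Definition crit : seq R :=
  sort <=%R (undup [seq diam_of s / 2 | s <- enum [pred s | `[< delaunay s >]]]).

Definition Ncrit := size crit.
Definition B (k i j : nat) : nat := pbetti k crit`_i crit`_j.
Definition Bm (k i j : nat) : nat := if i is i'.+1 then B k i' j else 0%N.

Definition mult (k i j : nat) : nat :=
  ((B k i j.-1 - B k i j) - (Bm k i j.-1 - Bm k i j))%N.
Definition mult_inf (k i : nat) : nat := (B k i Ncrit.-1 - Bm k i Ncrit.-1)%N.

(* k-dimensional persistence diagram: multiset of (birth, death) with death
   None standing for +oo *)
Definition dgm (k : nat) : seq (R * option R) :=
  flatten [seq flatten [seq nseq (mult k i j) (crit`_i, Some crit`_j)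
                       | j <- iota i.+1 (Ncrit - i.+1)] | i <- iota 0 Ncrit]
  ++ flatten [seq nseq (mult_inf k i) (crit`_i, None) | i <- iota 0 Ncrit].

End DR.

Section Bottleneck.
Variable R : realType.
Local Open Scope ereal_scope.

Definition dcost (u v : option R) : \bar R :=
  match u, v with
  | Some a, Some b => (`|a - b|)%:E
  | None, None => 0
  | _, _ => +oo
  end.

Definition linf (p q : R * option R) : \bar R :=
  maxe (`|p.1 - q.1|)%:E (dcost p.2 q.2).

(* augmented diagram: points of the diagram plus the diagonal, each diagonal
   point (x,x) with countably infinite multiplicity *)
Definition aug (D : seq (R * option R)) := ('I_(size D) + (R * nat))%type.

Definition aug_pt (D : seq (R * option R)) (a : aug D) : R * option R :=
  match a with
  | inl i => nth (0%R, None) D i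
  | inr (x, _) => (x, Some x)
  end.

Definition aug_cost (D1 D2 : seq (R * option R)) (a : aug D1) (b : aug D2) : \bar R :=
  match a, b with
  | inr _, inr _ => 0
  | _, _ => linf (aug_pt a) (aug_pt b)
  end.

Definition bottleneck (D1 D2 : seq (R * option R)) : \bar R :=
  ereal_inf [set ereal_sup (range (fun a => aug_cost a (f a)))
            | f in [set f : aug D1 -> aug D2 | bijective f]].
End Bottleneck.

Section GH.
Variable R : realType.
Local Open Scope ereal_scope.
Variables (d n m : nat) (X : 'I_n -> 'rV[R]_d) (Y : 'I_m -> 'rV[R]_d).

Definition correspondence (C : {set 'I_n * 'I_m}) : Prop :=
  (forall i, exists j, (i, j) \in C) /\ (forall j, exists i, (i, j) \in C).

Definition distortion (C : {set 'I_n * 'I_m}) : R :=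
  (\big[Num.max/0]_(p in C) \big[Num.max/0]_(q in C)
     `|edist (X p.1) (X q.1) - edist (Y p.2) (Y q.2)|)%R.

Definition dGH : \bar R :=
  ereal_inf [set ((distortion C) / 2)%:E | C in [set C | correspondence C]].
End GH.

Definition cDR (R : realType) (k : nat) : R :=
  Num.sqrt ((2 * k%:R) / (k%:R + 1)).

(* Main.v *)
(* Write r = t + h with h half the distortion of a correspondence, and Cech_s for
   the Cech complex of radius s.

   The inclusion of Cech_s(Y) /\ DEL(Y) into Cech_s(Y) is a homology equivalence:
   the non-Delaunay simplices Q of Cech_s(Y) are paired by toggling one vertex.
   To Q one attaches a centre z of a ball of radius s around Q together with a
   point y, chosen canonically, that is as close as possible to being the centre
   of an empty sphere through Q; some nearest point of y lies strictly inside the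
   ball, and adding it to Q or removing it changes neither z nor y.

   By Jung's theorem a simplex of dimension at most k + 1 and diameter at most 2r
   is in Cech_(c r), c = c_(k+1), and r only matters up to half the diameter.
   Hence on X + Y the (k+1)-simplices of DR_t(X) enter a mapping cylinder that
   retracts onto DR_(t+eps)(Y), eps = (c - 1) max(diam)/2 + h, and vice versa.
   As all maps are inclusions, H_k(DR_t(X)) -> H_k(DR_(t+eps)(Y)) has kernel and
   cokernel killed by a shift of 2 eps, and comparing ranks with those of its
   image gives the induced matching of Bauer and Lesnick.  The cost is eps, half
   of the claimed bound. *)

From HB Require Import structures.
From mathcomp Require Import topology normedtype derive.
Require Import Defs.
From mathcomp Require Import all_boot all_order all_algebra.
From mathcomp Require Import all_classical all_reals ereal.
From mathcomp Require Import zify ring lra.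
(* Restores the finite-set names that classical_sets shadows. *)
Import mathcomp.boot.fintype mathcomp.boot.finset.
Import Order.TTheory GRing.Theory Num.Theory.
Set Implicit Arguments. Unset Strict Implicit. Unset Printing Implicit Defensive.
Local Open Scope ring_scope.

(** * Simplicial chains and relative acyclicity *)

(** A correspondence controls distances but not the emptiness of spheres, so it cannot carry
    Delaunay simplices to Delaunay simplices. Cech complexes feel distances alone; hence the detour
    through them, with a homological rather than simplicial way back.

    The canonical z and y solve a convex programme. Its optimum is unique, stays put when a
    constraint satisfied there is added, and also when a constraint slack there is dropped; a
    nearest point strictly inside the ball is of both kinds, which is why toggling it is harmless.

    H_k sees only chains of degrees k and k + 1, so Jung's constant is taken for dimension k + 1 and
    not for the ambient one.

    Diagrams are handled through their counts of bars alive from s to t. These are ranks, and the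
    inequalities that drive the matching come from the Frobenius inequality and from monotonicity of
    rank. The matching moves endpoints one way only, by 0 to 2 eps; placing the diagram of [Y] at a
    shift of eps centres this interval and leaves eps. *)

Section Chains.
Variables (F : fieldType) (N : nat).
Implicit Types (s t : {set 'I_N}) (x : 'I_N) (v w : 'rV[F]_(NS N)).
Implicit Types K L : {set 'I_N} -> Prop.

Definition coef v s : F := v 0 (enum_rank s).

Lemma coefB v w s : coef (v - w) s = coef v s - coef w s.
Proof. by rewrite /coef !mxE. Qed.

Lemma coef0 s : coef 0 s = 0.
Proof. by rewrite /coef !mxE. Qed.

Lemma coef_eq v w : coef v =1 coef w -> v = w.
Proof.
move=> e; apply/rowP => j.
by have := e (enum_val j); rewrite /coef enum_valK.
Qed.

Definition mkchain (c : {set 'I_N} -> F) : 'rV[F]_(NS N) :=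
  \row_j c (enum_val j).

Lemma coef_mkchain c s : coef (mkchain c) s = c s.
Proof. by rewrite /coef mxE enum_rankK. Qed.

Definition incidence x s : F := (-1) ^+ #|[set u in s | (u < x)%N]|.

Lemma incidence_sqr x s : incidence x s * incidence x s = 1.
Proof. by rewrite /incidence -expr2 -exprM mulnC exprM sqrrN expr1n expr1n. Qed.

Lemma setU1_codim1 (x : 'I_N) s t : x \notin s ->
  [&& s \subset t, #|t| == #|s|.+1 & x \in t] = (t == x |: s).
Proof.
move=> xs; apply/and3P/eqP => [[st /eqP ct xt]|->].
  apply/esym/eqP; rewrite eqEcard subUset sub1set xt st /= cardsU1 xs ct.
  by rewrite add1n leqnn.
by rewrite subsetUr cardsU1 xs add1n eqxx setU11.
Qed.

(** Boundaries are read at the face, one term per missing vertex, because the later arguments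
    compare coefficients at a fixed simplex. The empty face gets 0: the complex is not augmented. *)
Lemma coef_bdry v s : coef (v *m bdry N F) s =
  if s == set0 then 0
  else \sum_(x | x \notin s) incidence x s * coef v (x |: s).
Proof.
rewrite /coef mxE.
rewrite (reindex (@enum_rank {set 'I_N})) /=; last first.
  by exists enum_val => i _; rewrite ?enum_rankK ?enum_valK.
under eq_bigr => t _ do rewrite mxE !enum_rankK /=.
case: ifPn => [/eqP ->|s0].
  by rewrite big1 // => t _; rewrite cards0 !andbF mulr0.
have cs : (0 < #|s|)%N by rewrite card_gt0.
rewrite cs.
transitivity (\sum_t \sum_(x | x \notin s)
    (if t == x |: s then incidence x s * v 0 (enum_rank t) else 0)).
  apply: eq_bigr => t _; rewrite andbT.
  case: ifPn => [/andP[st ct]|nst].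
    rewrite mulr_sumr [LHS]big_mkcond [RHS]big_mkcond; apply: eq_bigr => x _.
    rewrite !inE; have [//|xs] /= := boolP (x \in s).
    rewrite -(setU1_codim1 _ xs) st ct /=; case: ifP => // xt.
    rewrite mulrC /incidence; congr (_ ^+ _ * _).
    move: (setU1_codim1 t xs); rewrite st ct xt => /esym/eqP ->.
    apply: eq_card => u; rewrite !inE.
    by have [->|] := eqVneq u x; rewrite ?ltnn ?andbF.
  rewrite mulr0 big1 // => x xs; case: ifP => // /eqP e; case/negP: nst.
  by move: (setU1_codim1 t xs); rewrite e eqxx => /and3P[-> ->].
rewrite exchange_big; apply: eq_bigr => x xs /=.
by rewrite -big_mkcond big_pred1_eq.
Qed.

Lemma card_lt_setU1 x y s : x \notin s ->
  #|[set u in x |: s | (u < y)%N]| = ((x < y) + #|[set u in s | (u < y)%N]|)%N.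
Proof.
move=> xs; have [xy|xy] := ltnP x y.
  rewrite -[X in _ = (nat_of_bool X + _)%N]/true.
  have -> : [set u in x |: s | (u < y)%N] = x |: [set u in s | (u < y)%N].
    by apply/setP => u; rewrite !inE; have [->|] := eqVneq u x; rewrite ?xy.
  by rewrite cardsU1 !inE (negPf xs).
apply: eq_card => u; rewrite !inE; have [->|//] := eqVneq u x.
by rewrite (negPf xs) ltnNge xy.
Qed.

Lemma incidence_anticomm x y s : x != y -> x \notin s -> y \notin s ->
  incidence y (x |: s) * incidence x (y |: s)
  = - (incidence x s * incidence y s).
Proof.
move=> xy xs ys; rewrite /incidence !card_lt_setU1 // -!exprD.
have -> : ((x < y) + #|[set u in s | (u < y)%N]| +
    ((y < x) + #|[set u in s | (u < x)%N]|) =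
    (#|[set u in s | (u < x)%N]| + #|[set u in s | (u < y)%N]|).+1)%N.
  have := xy; rewrite -val_eqE /=; case: ltngtP => //= _ _;
    by rewrite ?add1n ?add0n addnC ?addSn ?addnS.
by rewrite exprS mulN1r.
Qed.

Lemma bdry_bdry v : v *m bdry N F *m bdry N F = 0.
Proof.
apply: coef_eq => s; rewrite coef0 coef_bdry.
case: ifPn => // s0.
have ne x : (x |: s == set0) = false.
  by apply/negbTE; apply/set0Pn; exists x; rewrite !inE eqxx.
pose a x y := incidence x s * (incidence y (x |: s) * coef v (y |: (x |: s))).
pose P x y := [&& x \notin s, y \notin s & x != y].
have -> : \sum_(x | x \notin s) incidence x s * coef (v *m bdry N F) (x |: s)
    = \sum_(p : 'I_N * 'I_N | P p.1 p.2) a p.1 p.2.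
  rewrite (eq_bigl (fun p => (p.1 \notin s) && (p.2 \notin p.1 |: s))); last first.
    move=> p; rewrite /P !inE negb_or (eq_sym p.2).
    by case: (p.1 \in s); case: (p.1 == p.2); rewrite ?andbF ?andbT.
  rewrite -(pair_big_dep (fun x => x \notin s)
    (fun x y => y \notin x |: s) (fun x y => a x y)) /=.
  by apply: eq_bigr => x xs; rewrite coef_bdry ne mulr_sumr.
(* Splitting by order pairs each term with its opposite; showing only that the sum equals its
   negative would not do in characteristic 2. *)
rewrite (bigID (fun p : 'I_N * 'I_N => (p.1 < p.2)%N)) /=.
rewrite [X in _ + X](reindex_inj (h := fun p : 'I_N * 'I_N => (p.2, p.1))) /=;
  last by move=> [? ?] [? ?] [-> ->].
rewrite [X in _ + X](eq_bigl (fun p => P p.1 p.2 && (p.1 < p.2)%N)); last first.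
  move=> p; rewrite /P -leqNgt leq_eqVlt eq_sym val_eqE.
  by case: (p.1 \in s); case: (p.2 \in s) => //=; case: eqVneq; rewrite ?ltnn.
rewrite -big_split big1 //= => -[x y] /= /andP[/and3P[xs ys xy] _].
rewrite /a setUCA !mulrA -mulrDl.
suff -> : incidence x s * incidence y (x |: s) +
    incidence y s * incidence x (y |: s) = 0 by rewrite mul0r.
have e := incidence_anticomm xy xs ys.
apply/eqP; rewrite -(mulrI_eq0 _ (x := incidence x s)); last first.
  by apply: mulfI; apply/eqP => h; have := incidence_sqr x s;
    rewrite h mul0r => /esym/eqP; rewrite oner_eq0.
rewrite mulrDr mulrA incidence_sqr mul1r mulrA.
rewrite -[incidence y (x |: s)]mulr1 -(incidence_sqr x (y |: s)).
by rewrite mulrA e mulNr addNr.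
Qed.

End Chains.
Section Homology.
Variables (F : fieldType) (N : nat).
Implicit Types (s t : {set 'I_N}) (x : 'I_N) (v w u : 'rV[F]_(NS N)).
Implicit Types (K L S : {set 'I_N} -> Prop) (k : nat).

Lemma coef_chains v K k s : coef (v *m chains F K k) s =
  if `[< K s /\ #|s| = k.+1 >] then coef v s else 0.
Proof.
rewrite /coef mxE (bigD1 (enum_rank s)) //= big1 => [|i ne].
  by rewrite mxE eqxx enum_rankK /= addr0; case: ifP; rewrite ?mulr1 ?mulr0.
by rewrite mxE (negPf ne) mulr0.
Qed.

Lemma chainsP v K k : (v <= chains F K k)%MS <->
  forall s, coef v s != 0 -> K s /\ #|s| = k.+1.
Proof.
split=> [/submxP[D ->] s|h].
  by rewrite coef_chains; case: ifPn => [/asboolP //|]; rewrite eqxx.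
suff <- : v *m chains F K k = v by apply: submxMl.
apply: coef_eq => s; rewrite coef_chains; case: ifPn => // /asboolP n.
by have [->//|/h /n] := eqVneq (coef v s) 0.
Qed.

Lemma cyclesP v K k : (v <= cycles F K k)%MS <->
  (v <= chains F K k)%MS /\ v *m bdry N F = 0.
Proof.
rewrite sub_capmx; split=> [/andP[-> /sub_kermxP//]|[-> h]].
by apply/sub_kermxP.
Qed.

Lemma boundariesP v K k : (v <= boundaries F K k)%MS <->
  exists2 u, (u <= chains F K k.+1)%MS & v = u *m bdry N F.
Proof.
split=> [/submxP[D ->]|[u hu ->]].
  by exists (D *m chains F K k.+1); rewrite ?submxMl // /boundaries mulmxA.
exact: submxMr.
Qed.

Definition face_closed K :=
  forall s t, K s -> t \subset s -> t != set0 -> K t.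

Lemma bdry_chains v K k : face_closed K -> (v <= chains F K k.+1)%MS ->
  (v *m bdry N F <= chains F K k)%MS.
Proof.
move=> Kc /chainsP hv; apply/chainsP => s.
rewrite coef_bdry; case: ifPn => [|s0 ne]; first by rewrite eqxx.
have [x xs] : exists2 x, x \notin s & coef v (x |: s) != 0.
  apply: contrapT => h; move: ne; rewrite big1 ?eqxx // => x xs.
  have [->|ne] := eqVneq (coef v (x |: s)) 0; first by rewrite mulr0.
  by case: h; exists x.
move=> /hv [Kx]; rewrite cardsU1 xs => -[c]; split => //.
by apply: Kc Kx _ s0; apply: subsetUr.
Qed.

Lemma chainsS K L k : (forall s, #|s| = k.+1 -> K s -> L s) ->
  (chains F K k <= chains F L k)%MS.
Proof.
move=> h; apply/rV_subP => v /chainsP hv; apply/chainsP => s /hv[Ks ck].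
by split=> //; apply: h.
Qed.

Lemma cyclesS K L k : (forall s, #|s| = k.+1 -> K s -> L s) ->
  (cycles F K k <= cycles F L k)%MS.
Proof.
move=> h; apply/rV_subP => v /cyclesP[hv v0]; apply/cyclesP; split=> //.
exact: submx_trans hv (chainsS h).
Qed.

Lemma boundariesS K L k : (forall s, #|s| = k.+2 -> K s -> L s) ->
  (boundaries F K k <= boundaries F L k)%MS.
Proof.
move=> h; apply/rV_subP => v /boundariesP[u hu ->].
apply/boundariesP; exists u => //; exact: submx_trans hu (chainsS h).
Qed.

(** For [L] inside [K] this is H_k(K, L) = 0. In degree k it makes H_k(L) -> H_k(K) onto, in degree
    k + 1 injective. *)
Definition relacyclic K L k := forall w, (w <= chains F K k)%MS ->
  (forall s, coef (w *m bdry N F) s != 0 -> L s) ->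
  exists2 u, (u <= chains F K k.+1)%MS &
    (w - u *m bdry N F <= chains F L k)%MS.

Lemma relacyclic_trans K L M k : (forall s, L s -> K s) ->
    (forall s, M s -> L s) -> relacyclic K L k -> relacyclic L M k ->
  relacyclic K M k.
Proof.
move=> LK ML KL LM w hw hM.
have [u hu hu'] := KL _ hw (fun s h => ML _ (hM s h)).
have [|u' hu1 hu2] := LM _ hu'.
  by move=> s; rewrite mulmxBl bdry_bdry subr0; apply: hM.
exists (u + u'); last by rewrite mulmxDl opprD addrA.
apply: addmx_sub => //; apply: submx_trans hu1 (chainsS _) => s _; exact: LK.
Qed.

(** A discrete Morse matching without critical simplices; [lev] excludes closed gradient paths. The
    premise is there because no apex function [x] exists when there are no vertices. *)
Definition toggleable S := (exists s, S s) -> exists (lev : {set 'I_N} -> nat)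
    (x : {set 'I_N} -> 'I_N),
  (forall s, S s -> [/\ S (x s |: s), S (s :\ x s),
     lev (x s |: s) = lev s & lev (s :\ x s) = lev s]) /\
  (forall s t, S s -> S t -> s \subset t ->
     (lev s <= lev t)%N /\ (lev s = lev t -> x s = x t)).

(* An acyclic matching s <-> s with x s toggled cancels the simplices outside L
   one level at a time, from the top; on one level the cone with apex x s is a
   contracting homotopy. *)
Lemma toggleable_relacyclic K L k : ~ K set0 -> face_closed K ->
    face_closed L -> (forall s, L s -> K s) ->
    toggleable (fun s => K s /\ ~ L s) -> relacyclic K L k.
Proof.
move=> K0 Kc Lc LK; set S := (fun s => K s /\ ~ L s) => togS.
have [/togS[lev [x [tog mono]]]|nS] := pselect (exists s, S s); last first.
  move=> w /chainsP hw _; exists 0; first exact: sub0mx.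
  rewrite mul0mx subr0; apply/chainsP => s /hw[Ks ck]; split=> //.
  by apply: contrapT => nL; apply: nS; exists s.
have Sne s : S s -> s != set0 by case=> Ks _; apply/eqP => e; rewrite e in Ks.
suff main M w : (w <= chains F K k)%MS ->
    (forall s, coef (w *m bdry N F) s != 0 -> L s) ->
    (forall s, coef w s != 0 -> S s -> (lev s < M)%N) ->
    exists2 u, (u <= chains F K k.+1)%MS &
      (w - u *m bdry N F <= chains F L k)%MS.
  move=> w hw hL; apply: (main (\max_(s : {set 'I_N}) lev s).+1) => //.
  by move=> s _ _; rewrite ltnS; apply: leq_bigmax.
elim: M w => [|M IH] w hw hL hM.
  exists 0; first exact: sub0mx.
  rewrite mul0mx subr0; apply/chainsP => s ne.
  have [Ks ck] := (chainsP _ _ _).1 hw s ne; split=> //.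
  by apply: contrapT => nL; have := hM s ne (conj Ks nL).
(* The cone over the part of [w] on level [M]: a simplex containing its apex receives the signed
   coefficient of the facet opposite to the apex. *)
pose c s : F := if `[< S s >] && (lev s == M) && (x s \in s)
  then incidence F (x s) (s :\ x s) * coef w (s :\ x s) else 0.
pose h := mkchain c.
have hh : (h <= chains F K k.+1)%MS.
  apply/chainsP => s; rewrite coef_mkchain /c.
  case: ifPn => [/andP[/andP[/asboolP Ss _] xs] ne|]; last by rewrite eqxx.
  split; first by case: Ss.
  have /((chainsP _ _ _).1 hw)[_ ck] : coef w (s :\ x s) != 0.
    by apply: contraNneq ne => ->; rewrite mulr0.
  by rewrite (cardsD1 (x s)) xs ck.
have level_zero s : S s -> (M <= lev s)%N -> coef (w - h *m bdry N F) s = 0.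
  move=> Ss Ms; have s0 := Sne _ Ss.
  rewrite coefB coef_bdry (negPf s0).
  move: Ms; rewrite leq_eqVlt => /orP[/eqP Ms|Ms]; last first.
    rewrite (_ : coef w s = 0); last first.
      apply/eqP; apply: contraLR Ms => /hM /(_ Ss); rewrite -leqNgt ltnS //.
    rewrite big1 ?subr0 // => y ys; rewrite coef_mkchain /c.
    case: ifPn => [/andP[/andP[/asboolP Sy /eqP ly] _]|_]; last by rewrite mulr0.
    by have [] := mono _ _ Ss Sy (subsetUr _ _); rewrite ly leqNgt Ms.
  have up y : S (y |: s) -> lev (y |: s) = M -> x (y |: s) = x s.
    by move=> Sy ly; have [_ ->] := mono _ _ Ss Sy (subsetUr _ _); rewrite // ly.
  have [xs|xs] := boolP (x s \in s); last first.
    have [S1 _ l1 _] := tog _ Ss.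
    rewrite (bigD1 (x s)) //= big1 ?addr0 => [|y /andP[ys yx]].
      have {}l1 : lev (x s |: s) = M by rewrite l1 -Ms.
      rewrite coef_mkchain /c up // (asboolT S1) l1 eqxx setU11 /= setU1K // mulrA incidence_sqr.
      by rewrite mul1r subrr.
    rewrite coef_mkchain /c; case: ifPn => [|_]; last by rewrite mulr0.
    move=> /andP[/andP[/asboolP Sy /eqP ly]]; rewrite up //.
    by rewrite !inE (negPf xs) orbF eq_sym (negPf yx).
  have [_ S1 _ l1] := tog _ Ss.
  set z := x s in xs S1 l1 up *; set r := s :\ z in S1 l1 *.
  have zr : z \notin r by rewrite !inE eqxx.
  have sE : s = z |: r by rewrite setD1K.
  have xr : x r = z.
    by have [_ ->] := mono _ _ S1 Ss (subD1set _ _).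
  (* [r] lies outside [L], so the boundary of [w] vanishes there. This expresses the coefficient at
     [s] by those at the other cofaces of [r], just as the boundary of [h] does. *)
  have wr : coef (w *m bdry N F) r = 0.
    by apply/eqP; apply: contrapT => /negP /hL; case: S1.
  move: wr; rewrite coef_bdry (negPf (Sne _ S1)) (bigD1 z) //= -sE.
  move=> /eqP; rewrite addr_eq0 => /eqP wr.
  rewrite -[coef w s]mul1r -(incidence_sqr F z r) -mulrA wr mulrN mulr_sumr.
  apply/eqP; rewrite subr_eq0 -sumrN; apply/eqP; apply: eq_big => [y|y].
    by rewrite sE !inE negb_or andbC.
  move=> /andP[yr yz]; rewrite coef_mkchain /c.
  have ys : y \notin s by rewrite sE in_setU1 negb_or yz yr.
  have rE : (y |: s) :\ z = y |: r.
    by rewrite {1}sE setUCA setU1K // in_setU1 negb_or (eq_sym z) yz zr.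
  case: ifPn => [|nS].
    move=> /andP[/andP[/asboolP Sy /eqP ly] _]; rewrite up // rE !mulrA.
    by rewrite sE incidence_anticomm 1?eq_sym // mulNr.
  (* Otherwise [y |: r] would lie on level [M] with apex [z], and toggling [z] would put [y |: s]
     into [S] on that level. *)
  rewrite mulr0 (_ : coef w (y |: r) = 0) ?mulr0 ?oppr0 //.
  apply/eqP; apply: contraNT nS => nw.
  have Sy : S (y |: r).
    split; first by have [] := (chainsP _ _ _).1 hw _ nw.
    by move=> Ly; apply: S1.2; apply: Lc Ly (subsetUr _ _) (Sne _ S1).
  have lt := hM _ nw Sy; have [le ex] := mono _ _ S1 Sy (subsetUr _ _).
  have ly : lev r = lev (y |: r) by apply/eqP; rewrite eqn_leq le l1 -Ms.
  have := tog _ Sy; rewrite -(ex ly) xr setUCA -sE => -[Sy' _ l2 _].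
  have ly' : lev (y |: s) = M by rewrite l2 -ly l1 Ms.
  by rewrite asboolT // ly' eqxx up // sE !inE eqxx orbT.
have [|s ne|s ne Ss|u hu hu'] := IH (w - h *m bdry N F).
- by apply: addmx_sub => //; rewrite eqmx_opp; apply: bdry_chains.
- by apply: hL; move: ne; rewrite mulmxBl bdry_bdry subr0.
- by rewrite ltnNge; apply: contraNN ne => /level_zero ->.
exists (h + u); first exact: addmx_sub.
by rewrite mulmxDl opprD addrA.
Qed.

End Homology.

(** * Ranks of images in quotients *)

Section RelativeRank.
Variables (F : fieldType) (V : nat).
Implicit Types (Z B U : 'M[F]_V).

(** Dimension of the image of [Z] in the quotient by [B]; for cycles and boundaries of a filtration,
    a persistent Betti number. *)
Definition relrank m1 m2 (Z : 'M[F]_(m1, V)) (B : 'M[F]_(m2, V)) : nat :=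
  (\rank Z - \rank (Z :&: B)%MS)%N.

Lemma relrankE m1 m2 (Z : 'M[F]_(m1, V)) (B : 'M[F]_(m2, V)) :
  (relrank Z B + \rank B = \rank (Z + B)%MS)%N.
Proof.
rewrite /relrank; have := mxrank_sum_cap Z B.
have := mxrankS (capmxSl Z B); lia.
Qed.

(** By the modular law for [Z + B'] and [Z' + B]: their sum contains [Z + B], their intersection
    [Z' + B']. This makes multiplicities nonnegative and also yields the kernel and cokernel
    comparisons. *)
Lemma relrank_Frobenius Z Z' B B' : (Z' <= Z)%MS -> (B' <= B)%MS ->
  (relrank Z B + relrank Z' B' <= relrank Z B' + relrank Z' B)%N.
Proof.
move=> ZZ BB.
suff : (\rank (Z + B)%MS + \rank (Z' + B')%MS
    <= \rank (Z + B')%MS + \rank (Z' + B)%MS)%N.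
  by rewrite -!relrankE; lia.
rewrite -(mxrank_sum_cap (Z + B')%MS (Z' + B)%MS).
apply: leq_add; apply: mxrankS.
  rewrite addsmx_sub.
  by rewrite (submx_trans (addsmxSl Z B') (addsmxSl _ _))
    (submx_trans (addsmxSr Z' B) (addsmxSr _ _)).
by rewrite sub_capmx addsmxS // addsmxS.
Qed.

Lemma relrank_leq Z Z' B B' : (Z' <= Z)%MS -> (B' <= B)%MS ->
  (relrank Z' B <= relrank Z B')%N.
Proof.
move=> ZZ BB; apply: (@leq_trans (relrank Z B)).
  have := mxrankS (addsmxS ZZ (submx_refl B)); rewrite -!relrankE; lia.
by rewrite /relrank leq_sub2l // mxrankS // capmxS.
Qed.

(** Lets an inclusion known only for [Z :&: B] serve where monotonicity asks for one of [B]. *)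
Lemma relrank_cap Z Z' B : (Z' <= Z)%MS ->
  relrank Z' (Z :&: B)%MS = relrank Z' B.
Proof.
move=> ZZ; rewrite /relrank; congr (_ - _)%N; apply/eqP.
rewrite eqn_leq; apply/andP; split; apply: mxrankS.
  by rewrite capmxS ?capmxSr.
by rewrite !sub_capmx capmxSl capmxSr (submx_trans (capmxSl _ _)).
Qed.

Lemma relrank_eq Z Z' B : (Z <= Z' + B)%MS -> (Z' <= Z + B)%MS ->
  relrank Z B = relrank Z' B.
Proof.
move=> h1 h2; apply/eqP; rewrite -(eqn_add2r (\rank B)) !relrankE eqn_leq.
by rewrite !mxrankS // addsmx_sub ?h1 ?h2 addsmxSr.
Qed.

End RelativeRank.

(** * Complexes transported to a larger vertex set *)

Section Embedding.
Variables (F : fieldType) (n N : nat) (e : 'I_n -> 'I_N).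
Hypothesis e_mono : {mono e : i j / (i < j)%N}.
Implicit Types (K L : {set 'I_n} -> Prop) (k : nat).
Implicit Types (t : {set 'I_n}) (s : {set 'I_N}).
Implicit Types (u : 'rV[F]_(NS n)) (v : 'rV[F]_(NS N)).

Lemma mono_ord_inj : injective e.
Proof.
move=> i j eij; apply/eqP; rewrite -val_eqE eqn_leq.
by rewrite leqNgt -e_mono eij ltnn /= leqNgt -e_mono eij ltnn.
Qed.
Let e_inj := mono_ord_inj.

Definition push K s := exists2 t, K t & s = e @: t.

Definition push_mx : 'M[F]_(NS n, NS N) :=
  \matrix_(i, j) (enum_val j == e @: (enum_val i : {set 'I_n}))%:R.

Lemma coef_push u t : coef (u *m push_mx) (e @: t) = coef u t.
Proof.
rewrite /coef mxE (bigD1 (enum_rank t)) //= big1 => [|i ne].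
  by rewrite mxE !enum_rankK eqxx mulr1 addr0.
rewrite mxE enum_rankK; case: eqP => [/(imset_inj e_inj) e'|]; rewrite ?mulr0 //.
by rewrite e' enum_valK eqxx in ne.
Qed.

Lemma coef_push0 u s : (forall t : {set 'I_n}, s <> e @: t) ->
  coef (u *m push_mx) s = 0.
Proof.
move=> h; rewrite /coef mxE big1 // => i _; rewrite mxE enum_rankK.
by case: eqP => [/h //|]; rewrite mulr0.
Qed.

Lemma push_mx_free : row_free push_mx.
Proof.
apply/inj_row_free => v v0; apply: coef_eq => t.
by rewrite -coef_push v0 !coef0.
Qed.

(** Signs count smaller vertices, so they survive because [e] preserves the order; a mere injection
    could change them. *)
Lemma incidence_push x t : incidence F (e x) (e @: t) = incidence F x t.
Proof.
rewrite /incidence; congr (_ ^+ _).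
rewrite -[RHS](card_imset _ e_inj); apply: eq_card => u; apply/idP/imsetP.
  rewrite inE => /andP[/imsetP[y yt ->]]; rewrite e_mono => yx.
  by exists y; rewrite // inE yt.
by case=> y + ->; rewrite !inE => /andP[yt yx]; rewrite imset_f // e_mono.
Qed.

Lemma imset_sub_image t s : s \subset e @: t ->
  exists t' : {set 'I_n}, s = e @: t'.
Proof.
move=> st; exists (e @^-1: s); apply/setP => y; apply/idP/imsetP.
  move=> ys; have /imsetP[x xt yx] := subsetP st _ ys.
  by exists x; rewrite // inE -yx.
by case=> x; rewrite inE => xs ->.
Qed.

Lemma bdry_push u :
  u *m push_mx *m bdry N F = u *m bdry n F *m push_mx.
Proof.
apply: coef_eq => s; rewrite coef_bdry.
have [[t ->]|h] := pselect (exists t : {set 'I_n}, s = e @: t); last first.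
  rewrite coef_push0; last by move=> t st; apply: h; exists t.
  case: ifP => // _; rewrite big1 // => y ys; rewrite coef_push0 ?mulr0 // => t ty.
  by apply: h; apply: (@imset_sub_image t); rewrite -ty subsetUr.
rewrite coef_push coef_bdry imset_eq0; case: ifP => // _.
rewrite (bigID (mem (codom e))) /= addrC big1 ?add0r => [|y /andP[ys ye]].
  rewrite (eq_bigl (mem (e @: ~: t))) => [|y].
    rewrite big_imset /=; last by move=> ? ? _ _; apply: e_inj.
    apply: eq_big => [x|x _]; first by rewrite inE.
    by rewrite incidence_push -imsetU1 coef_push.
  apply/andP/imsetP => [[ys /codomP[x xy]]|[x]]; last first.
    by rewrite inE => xt ->; rewrite mem_imset // codom_f.
  by exists x; rewrite // inE; apply: contraNN ys => xt; rewrite xy imset_f.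
rewrite coef_push0 ?mulr0 // => t' ty; case/negP: ye.
have : y \in e @: t' by rewrite -ty setU11.
by case/imsetP => x _ ->; apply: codom_f.
Qed.

Lemma chains_push K k v : (v <= chains F (push K) k)%MS <->
  exists2 u, (u <= chains F K k)%MS & v = u *m push_mx.
Proof.
split=> [/chainsP hv|[u /chainsP hu ->]].
  exists (mkchain (fun t => coef v (e @: t))).
    apply/chainsP => t; rewrite coef_mkchain => /hv[[t' Kt /(imset_inj e_inj) ->]].
    by rewrite card_imset.
  apply: coef_eq => s; have [[t ->]|h] := pselect (exists t : {set 'I_n}, s = e @: t).
    by rewrite coef_push coef_mkchain.
  rewrite coef_push0; last by move=> t st; apply: h; exists t.
  by apply/eqP; apply: contrapT => /negP /hv[[t _ st] _]; apply: h; exists t.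
apply/chainsP => s; have [[t ->]|h] := pselect (exists t : {set 'I_n}, s = e @: t).
  by rewrite coef_push card_imset // => /hu[Kt ->]; split=> //; exists t.
by rewrite coef_push0 ?eqxx // => t st; apply: h; exists t.
Qed.

Lemma cycles_push K k v : (v <= cycles F (push K) k)%MS <->
  exists2 u, (u <= cycles F K k)%MS & v = u *m push_mx.
Proof.
rewrite cyclesP chains_push; split=> [[[u hu ->]]|[u /cyclesP[hu u0] ->]].
  rewrite bdry_push => /eqP; rewrite mulmx_free_eq0 ?push_mx_free // => /eqP u0.
  by exists u => //; apply/cyclesP.
by split; [exists u|rewrite bdry_push u0 mul0mx].
Qed.

Lemma boundaries_push K k v : (v <= boundaries F (push K) k)%MS <->
  exists2 u, (u <= boundaries F K k)%MS & v = u *m push_mx.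
Proof.
rewrite boundariesP; split.
  case=> w /chains_push[u hu ->] ->; exists (u *m bdry n F); last first.
    by rewrite bdry_push.
  by apply/boundariesP; exists u.
case=> u /boundariesP[w hw ->] ->; exists (w *m push_mx).
  by apply/chains_push; exists w.
by rewrite bdry_push.
Qed.

Lemma relrank_push K L k :
  relrank (cycles F (push K) k) (boundaries F (push L) k)
  = relrank (cycles F K k) (boundaries F L k).
Proof.
have eqm V (A : 'M[F]_(NS N)) (A' : 'M[F]_(V, NS n)) :
    (forall v, (v <= A)%MS <-> exists2 u, (u <= A')%MS & v = u *m push_mx) ->
    (A :=: A' *m push_mx)%MS.
  move=> h; apply/eqmxP/andP; split; apply/rV_subP => v.
    by case/h => u hu ->; apply: submxMr.
  by case/submxP => D ->; apply/h; exists (D *m A'); rewrite ?submxMl ?mulmxA.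
have [eZ eB] := (eqm _ _ _ (cycles_push K k), eqm _ _ _ (boundaries_push L k)).
apply/eqP; rewrite -(eqn_add2r (\rank (boundaries F L k))) relrankE.
rewrite -(mxrankMfree (boundaries F L k) push_mx_free) -eB relrankE.
rewrite (adds_eqmx eZ eB) -addsmxMr mxrankMfree ?push_mx_free //.
Qed.

Lemma relacyclic_push K L k : relacyclic F K L k ->
  relacyclic F (push K) (push L) k.
Proof.
move=> KL _ /chains_push[w hw ->] hL.
have [|u hu hu'] := KL _ hw.
  move=> t ne; have := hL (e @: t); rewrite bdry_push coef_push => /(_ ne).
  by case=> t' Lt /(imset_inj e_inj) ->.
exists (u *m push_mx); first by apply/chains_push; exists u.
by rewrite bdry_push -mulmxBl; apply/chains_push; exists (w - u *m bdry n F).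
Qed.

Lemma face_closed_push K : face_closed K -> face_closed (push K).
Proof.
move=> Kc s r [t Kt ->] /[dup] /imset_sub_image[t' ->] st r0; exists t' => //.
apply: Kc Kt _ _.
  apply/subsetP => x xt; have := subsetP st (e x) (imset_f _ xt).
  by rewrite mem_imset.
by apply: contraNneq r0 => ->; rewrite imset0.
Qed.

End Embedding.
(** * Cech and Delaunay complexes *)

Section SquaredNorm.
Variables (R : realType) (d : nat).
Implicit Types (u v w : 'rV[R]_d) (a b : R).

Lemma dotvC u v : dotv u v = dotv v u.
Proof. by apply: eq_bigr => l _; rewrite mulrC. Qed.

Lemma dotvDl u v w : dotv (u + v) w = dotv u w + dotv v w.
Proof. by rewrite -big_split; apply: eq_bigr => l _; rewrite mxE mulrDl. Qed.

Lemma dotvZl a u w : dotv (a *: u) w = a * dotv u w.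
Proof. by rewrite [RHS]mulr_sumr; apply: eq_bigr => l _; rewrite mxE mulrA. Qed.

Lemma dotvDr u v w : dotv w (u + v) = dotv w u + dotv w v.
Proof. by rewrite dotvC dotvDl !(dotvC w). Qed.

Lemma dotvZr a u w : dotv w (a *: u) = a * dotv w u.
Proof. by rewrite dotvC dotvZl dotvC. Qed.

Lemma dotvNl u w : dotv (- u) w = - dotv u w.
Proof. by rewrite -scaleN1r dotvZl mulN1r. Qed.

Lemma dotvNr u w : dotv w (- u) = - dotv w u.
Proof. by rewrite dotvC dotvNl dotvC. Qed.

Definition dotvE := (dotvDl, dotvDr, dotvNl, dotvNr, dotvZl, dotvZr).

Definition sqn u : R := dotv u u.

Lemma sqn_ge0 u : 0 <= sqn u.
Proof. by apply: sumr_ge0 => l _; rewrite -expr2 sqr_ge0. Qed.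

Lemma sqn_eq0 u : sqn u = 0 -> u = 0.
Proof.
move=> h; apply/rowP => l; rewrite mxE; apply/eqP.
have /psumr_eq0P := h; rewrite -sqrf_eq0 expr2 => -> // i _.
by rewrite -expr2 sqr_ge0.
Qed.

Lemma sqnN u : sqn (- u) = sqn u.
Proof. by rewrite /sqn !dotvE opprK. Qed.

Lemma sqn_sub u v : sqn (u - v) = sqn (v - u).
Proof. by rewrite -sqnN opprB. Qed.

Lemma sqn_sub_le u v : sqn (u - v) <= 2 * sqn u + 2 * sqn v.
Proof.
by have := sqn_ge0 (u + v); rewrite /sqn !dotvE (dotvC v u); lra.
Qed.

Lemma edist_ge0 u v : 0 <= edist u v.
Proof. exact: sqrtr_ge0. Qed.

Lemma edist_sqn u v a : 0 <= a -> (edist u v <= a) = (sqn (u - v) <= a ^+ 2).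
Proof.
by move=> a0; rewrite /edist -{1}(ger0_norm a0) -sqrtr_sqr ler_sqrt ?sqr_ge0.
Qed.

Lemma ler_edist u v w w' :
  (edist u v <= edist w w') = (sqn (u - v) <= sqn (w - w')).
Proof. by rewrite /edist ler_sqrt // sqn_ge0. Qed.

Definition segment a u v : 'rV[R]_d := (1 - a) *: u + a *: v.

(** Stewart's identity. The correction term does not involve [w]: squared distances are strictly
    convex along a segment, while their differences are affine. *)
Lemma sqn_segment_sub a u v w : sqn (segment a u v - w) =
  (1 - a) * sqn (u - w) + a * sqn (v - w) - a * (1 - a) * sqn (u - v).
Proof.
by rewrite /segment /sqn !dotvE (dotvC v u) (dotvC w u) (dotvC w v); ring.
Qed.

Lemma sqn_segment a u v : sqn (segment a u v) =
  (1 - a) * sqn u + a * sqn v - a * (1 - a) * sqn (u - v).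
Proof. by have := sqn_segment_sub a u v 0; rewrite !subr0. Qed.

End SquaredNorm.

Section Continuity.
Import numFieldNormedType.Exports.
Local Open Scope classical_set_scope.
Variables (R : realType) (d : nat).

Lemma sqn_continuous (T : topologicalType) (f : T -> 'rV[R]_d) (w : 'rV[R]_d) :
  continuous f -> continuous (fun p => sqn (f p - w)).
Proof.
move=> cf; rewrite /sqn /dotv.
apply: continuous_big => [|l _ p]; first exact: add_continuous.
have cl : continuous (fun p => (f p - w) 0 l).
  move=> q; have -> : (fun p => (f p - w) 0 l) = (fun p => f p 0 l - w 0 l).
    by apply/funext => z; rewrite !mxE.
  apply: cvgB; last exact: cvg_cst.
  exact: (cvg_comp _ _ (cf q) (@coord_continuous _ 1 d 0 l (f q))).
by apply: cvgM; apply: cl.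
Qed.

Lemma closed_le_fun (T : topologicalType) (f g : T -> R) :
  continuous f -> continuous g -> closed [set p | f p <= g p].
Proof.
move=> cf cg; have -> : [set p | f p <= g p] =
    (fun p => f p - g p) @^-1` [set a | a <= 0].
  by apply/seteqP; split=> p /=; rewrite subr_le0.
apply: closed_comp; last exact: closed_le.
by move=> p _; apply: cvgB; [apply: cf|apply: cg].
Qed.

Lemma sqn_ball_compact (r : R) : compact [set y : 'rV[R]_d | sqn y <= r].
Proof.
apply: bounded_closed_compact.
  (* The norm is the maximum of the coordinates, and a^2 <= r gives a <= r + 1 without a square
     root. *)
  exists (r + 1); split; first exact: num_real.
  move=> M rM y /= yr; rewrite [leLHS]/Num.norm /= mx_normrE; apply: bigmax_le => [|[i j] _ /=].
    by have := sqn_ge0 y; lra.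
  have : y i j ^+ 2 <= sqn y.
    rewrite /sqn /dotv (bigD1 j) //= ord1 -expr2 lerDl; apply: sumr_ge0 => l _.
    by rewrite -expr2 sqr_ge0.
  have := sqn_ge0 y.
  rewrite -(real_normK (num_real (y i j))); move: `|y i j| (normr_ge0 (y i j)).
  by move=> a a0 s0 as1; nra.
have -> : [set y : 'rV[R]_d | sqn y <= r] = [set y | sqn (y - 0) <= r].
  by apply/seteqP; split=> y /=; rewrite subr0.
apply: closed_le_fun; last exact: cst_continuous.
by apply: sqn_continuous => y; apply: cvg_id.
Qed.

End Continuity.
Section CechDelaunay.
Import numFieldNormedType.Exports.
Variables (R : realType) (d n : nat) (X : 'I_n -> 'rV[R]_d) (s2 : R).
Implicit Types (Q : {set 'I_n}) (p : R * 'rV[R]_d * 'rV[R]_d) (t a : R).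

Definition in_cech Q := exists z, forall q, q \in Q -> sqn (z - X q) <= s2.

(** [y] lies in the Voronoi cell of every point of [Q]; taking [j] in [Q] shows that these points
    are equidistant from [y]. *)
Definition empty_center Q (y : 'rV[R]_d) :=
  forall q j, q \in Q -> sqn (y - X q) <= sqn (y - X j).

Lemma delaunay_center Q :
  delaunay X Q <-> Q != set0 /\ exists y, empty_center Q y.
Proof.
split=> [[Q0 [c [rho [onQ out]]]]|[Q0 [y yQ]]]; split=> //.
  exists c => q j qQ; rewrite sqn_sub [leRHS]sqn_sub -ler_edist onQ //.
have [q0 q0Q] := set0Pn _ Q0.
exists y, (edist (X q0) y); split=> [i iQ|j].
  by apply/eqP; rewrite eq_le !ler_edist !(sqn_sub _ y) !yQ.
by rewrite ler_edist !(sqn_sub _ y) yQ.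
Qed.

(* Points p = (gamma, z, y): z is the centre of a ball of squared radius s2
   containing Q, and gamma bounds how far y is from being the centre of an
   empty sphere through Q. *)
Variables (r2 G : R).
Definition feasible Q p :=
  [/\ 0 <= p.1.1 <= G, sqn p.1.2 <= r2 /\ sqn p.2 <= r2,
      forall q, q \in Q -> sqn (p.1.2 - X q) <= s2 &
      forall q j, q \in Q -> sqn (p.2 - X q) - sqn (p.2 - X j) <= p.1.1].

(** For small [t] the defect gamma has priority; the quadratic term makes the minimiser unique. *)
Definition objective t p := p.1.1 + t * (sqn p.2 + sqn p.1.2).

Definition comb a p p' : R * 'rV[R]_d * 'rV[R]_d :=
  ((1 - a) * p.1.1 + a * p'.1.1, segment a p.1.2 p'.1.2, segment a p.2 p'.2).

Lemma feasibleS Q Q' p : Q \subset Q' -> feasible Q' p -> feasible Q p.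
Proof.
move=> /subsetP QQ [h1 h2 h3 h4]; split=> // [q /QQ|q j /QQ]; auto.
Qed.

Lemma sqn_segment_le a (u v w : 'rV[R]_d) b : 0 <= a <= 1 ->
  (1 - a) * sqn (u - w) + a * sqn (v - w) <= b -> sqn (segment a u v - w) <= b.
Proof.
move=> /andP[a0 a1]; rewrite sqn_segment_sub.
have : 0 <= a * (1 - a) * sqn (u - v).
  by rewrite mulr_ge0 ?sqn_ge0 // mulr_ge0 // subr_ge0.
by lra.
Qed.

Lemma sqn_segment_diff a (u v w w' : 'rV[R]_d) :
  sqn (segment a u v - w) - sqn (segment a u v - w') =
  (1 - a) * (sqn (u - w) - sqn (u - w')) + a * (sqn (v - w) - sqn (v - w')).
Proof. by rewrite !sqn_segment_sub; ring. Qed.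

Lemma comb_in_box a p p' : 0 <= a <= 1 ->
  0 <= p.1.1 <= G -> 0 <= p'.1.1 <= G ->
  sqn p.1.2 <= r2 /\ sqn p.2 <= r2 -> sqn p'.1.2 <= r2 /\ sqn p'.2 <= r2 ->
  0 <= (comb a p p').1.1 <= G /\
  (sqn (comb a p p').1.2 <= r2 /\ sqn (comb a p p').2 <= r2).
Proof.
move=> a01 /andP[? ?] /andP[? ?] [? ?] [? ?]; have /andP[? ?] := a01.
have h (u v : 'rV[R]_d) : sqn u <= r2 -> sqn v <= r2 ->
    sqn (segment a u v) <= r2.
  by move=> hu hv; rewrite -[segment _ _ _]subr0 sqn_segment_le // !subr0; nra.
by split; [rewrite /comb /=; nra | split; apply: h].
Qed.

Lemma feasible_comb Q a p p' : 0 <= a <= 1 -> feasible Q p -> feasible Q p' ->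
  feasible Q (comb a p p').
Proof.
move=> a01 [h1 h2 h3 h4] [h1' h2' h3' h4'].
have [? ?] := comb_in_box a01 h1 h1' h2 h2'; have /andP[? ?] := a01.
split=> // [q qQ|q j qQ].
  by apply: sqn_segment_le => //; have := h3 _ qQ; have := h3' _ qQ; nra.
rewrite sqn_segment_diff /=; have := h4 _ j qQ; have := h4' _ j qQ; nra.
Qed.

Lemma objective_comb t a p p' : objective t (comb a p p') =
  (1 - a) * objective t p + a * objective t p'
  - t * (a * (1 - a)) * (sqn (p.2 - p'.2) + sqn (p.1.2 - p'.1.2)).
Proof. by rewrite /objective /= !sqn_segment; ring. Qed.

Definition optimal t Q p :=
  feasible Q p /\ forall p', feasible Q p' -> objective t p <= objective t p'.

Lemma optimal_exists t Q p0 : feasible Q p0 -> exists p, optimal t Q p.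
Proof.
move=> h0.
pose A : set (R * 'rV[R]_d * 'rV[R]_d) := [set p | feasible Q p]%classic.
have cy (w : 'rV[R]_d) : continuous (fun p : R * 'rV[R]_d * 'rV[R]_d => sqn (p.2 - w)).
  by apply: sqn_continuous => p; apply: cvg_snd.
have c1 : continuous (fun p : R * 'rV[R]_d * 'rV[R]_d => p.1.1).
  by move=> p; apply: cvg_comp cvg_fst cvg_fst.
have cz (w : 'rV[R]_d) : continuous (fun p : R * 'rV[R]_d * 'rV[R]_d => sqn (p.1.2 - w)).
  by apply: sqn_continuous => p; apply: cvg_comp cvg_fst cvg_snd.
have cc a : continuous (fun p : R * 'rV[R]_d * 'rV[R]_d => a) by move=> p; apply: cvg_cst.
have cA : compact A.
  pose Bx : set (R * 'rV[R]_d * 'rV[R]_d) := ((`[0, G] `*`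
    [set z : 'rV[R]_d | sqn z <= r2]) `*` [set y : 'rV[R]_d | sqn y <= r2])%classic.
  apply: (@subclosed_compact _ A Bx).
  - have -> : A = ([set p | 0 <= p.1.1] `&` [set p | p.1.1 <= G]
      `&` [set p | sqn (p.1.2 - 0) <= r2] `&` [set p | sqn (p.2 - 0) <= r2]
      `&` (\bigcap_(q in [set q | q \in Q]) [set p | sqn (p.1.2 - X q) <= s2])
      `&` (\bigcap_(qj in [set qj : 'I_n * 'I_n | qj.1 \in Q])
         [set p | sqn (p.2 - X qj.1) - sqn (p.2 - X qj.2) <= p.1.1]))%classic.
      apply/seteqP; split=> p /=.
        move=> [/andP[? ?] [? ?] h3 h4]; rewrite !subr0.
        split; last by move=> [q j] /= /h4.
        by split=> // q /= /h3.
      rewrite !subr0 => -[[[[[? ?] ?] ?] h3] h4]; split=> //; first exact/andP.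
      by move=> q j qQ; apply: (h4 (q, j)).
    do !apply: closedI;
      try by apply: closed_le_fun; solve [exact: c1 | exact: cc | exact: cz | exact: cy].
      by apply: closed_bigI => q _; apply: closed_le_fun; [exact: cz | exact: cc].
    apply: closed_bigI => -[q j] _; apply: closed_le_fun => // p.
    by apply: cvgB; apply: cy.
  - apply: compact_setX; first apply: compact_setX.
    + exact: segment_compact.
    + exact: sqn_ball_compact.
    + exact: sqn_ball_compact.
  by move=> p [h1 [h2 h3] _ _]; rewrite /Bx /= in_itv.
have cobj : continuous (objective t).
  move=> p; rewrite /objective; apply: cvgD; first exact: c1.
  apply: cvgM; first exact: cvg_cst.
  by apply: cvgD; [have := cy 0 p|have := cz 0 p];
    under eq_fun do rewrite subr0.
have A0 : (A !=set0)%classic by exists p0.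
have [p pA pmin] := compact_EVT_min A0 cA (continuous_subspaceT cobj).
exists p; split=> [|p' p'A]; first exact: set_mem pA.
apply: pmin; exact/mem_set.
Qed.

Lemma optimal_unique t Q p p' : 0 < t -> optimal t Q p -> feasible Q p' ->
  objective t p' <= objective t p -> p = p'.
Proof.
move=> t0 [fp minp] fp' le.
(* The midpoint would beat the minimum unless both z and y agree; gamma is then fixed by the value
   of the objective. *)
have := minp _ (feasible_comb (a := 2^-1) _ fp fp').
rewrite objective_comb => /(_ ltac:(lra)).
have g1 := sqn_ge0 (p.2 - p'.2); have g2 := sqn_ge0 (p.1.2 - p'.1.2).
move=> h; have e : sqn (p.2 - p'.2) + sqn (p.1.2 - p'.1.2) = 0 by nra.
have /sqn_eq0/subr0_eq e1 : sqn (p.2 - p'.2) = 0 by lra.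
have /sqn_eq0/subr0_eq e2 : sqn (p.1.2 - p'.1.2) = 0 by lra.
have := minp _ fp'; move: e1 e2 le; clear.
case: p p' => [[a z] y] [[a' z'] y']; rewrite /objective /= => -> -> h1 h2.
by congr (_, _, _); move: h1 h2; lra.
Qed.

(** A constraint that is slack at one end of a segment stays satisfied near that end, whatever
    happens at the other. *)
Lemma small_weight (u v b c : R) : u < b ->
  exists2 a0, 0 < a0 <= 1 &
    forall a, 0 <= a <= a0 -> (1 - a) * u + a * v <= (1 - a) * b + a * c.
Proof.
move=> ub; pose D := b - u + `|v - c|.
have nv := ler_norm (v - c); have n0 := normr_ge0 (v - c).
have D0 : 0 < D by rewrite /D; lra.
exists ((b - u) / D); first by rewrite divr_gt0 ?subr_gt0 //= ler_pdivrMr // /D; lra.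
move=> a /andP[a0]; rewrite ler_pdivlMr // => aD.
have : a * (v - c) <= a * `|v - c| by rewrite ler_wpM2l.
by move: aD; rewrite /D; lra.
Qed.

Definition near_point p (x : 'I_n) :=
  (forall j, sqn (p.2 - X x) <= sqn (p.2 - X j)) /\ sqn (p.1.2 - X x) < s2.

(* Otherwise moving y towards z would decrease gamma in proportion: seen from z
   the nearest points of y are at least as far as the points of Q. *)
Lemma near_point_exists t Q p : 0 < t -> Q != set0 -> optimal t Q p ->
  t * r2 < p.1.1 -> exists x, near_point p x.
Proof.
move=> t0 /set0Pn[q0 q0Q] [[/andP[g0 gG] [z2 y2] zQ yQ] pmin] gt.
apply: contrapT => none.
pose c := [arg min_(j < q0) sqn (p.2 - X j)]%O.
have cmin j : sqn (p.2 - X c) <= sqn (p.2 - X j).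
  by rewrite /c; case: Order.TotalTheory.arg_minP => // i _; apply.
have /choice[a aP] : forall j, exists a0, 0 < a0 <= 1 /\
    forall a, 0 <= a <= a0 -> forall q, q \in Q ->
      sqn (segment a p.2 p.1.2 - X q) - sqn (segment a p.2 p.1.2 - X j)
      <= (1 - a) * p.1.1.
  (* If [j] is nearest to y, then by [none] it is no closer to z than the ball radius, so the
     difference at z is at most 0 and every step size works. Otherwise its constraint is slack at y
     and small steps work. *)
  move=> j; have [jc|jc] := leP (sqn (p.2 - X j)) (sqn (p.2 - X c)).
    exists 1; rewrite ltr01 lexx; split=> // a /andP[a0 a1] q qQ.
    rewrite sqn_segment_diff.
    have zj : s2 <= sqn (p.1.2 - X j).
      rewrite leNgt; apply/negP => zj; apply: none; exists j; split=> // i.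
      exact: le_trans jc (cmin i).
    have := zQ _ qQ; have := yQ _ j qQ; nra.
  have [a0 a01 ha] := @small_weight (p.1.1 - (sqn (p.2 - X j) - sqn (p.2 - X c)))
    s2 p.1.1 0 ltac:(lra).
  exists a0; split=> // a aa0 q qQ; apply: le_trans (_ : (1 - a) * p.1.1 + a * 0 <= _);
    last by rewrite mulr0 addr0.
  apply: le_trans (ha a aa0); rewrite sqn_segment_diff; apply: lerD.
    rewrite ler_wpM2l //; first by case/andP: aa0 a01 => ? ? /andP[? ?]; lra.
    by have := yQ _ c qQ; lra.
  rewrite ler_wpM2l //; first by case/andP: aa0.
  by have := zQ _ qQ; have := sqn_ge0 (p.1.2 - X j); lra.
pose m := \big[Num.min/1]_j a j.
have m01 : 0 < m <= 1.
  apply/andP; split; last exact: bigmin_le_id.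
  by apply/lt_bigmin => //; move=> j _; case: (aP j) => /andP[].
have mle j : 0 <= m <= a j by case/andP: m01 => /ltW -> _; apply: bigmin_le.
have /andP[m0 m1] := m01.
(* Gamma falls by [m * p.1.1] and the quadratic term grows by at most [m * (t * r2)], which is
   less. *)
pose p' : R * 'rV[R]_d * 'rV[R]_d := ((1 - m) * p.1.1, p.1.2, segment m p.2 p.1.2).
have fp' : feasible Q p'.
  split=> /=.
  - by apply/andP; split; nra.
  - split=> //; rewrite -[segment _ _ _]subr0 sqn_segment_le ?subr0 //; nra.
  - by [].
  - by move=> q j qQ; apply: (aP j).2.
have := pmin _ fp'; rewrite /objective /= sqn_segment.
have := sqn_ge0 (p.2 - p.1.2); have y0 := sqn_ge0 p.2.
set A := sqn (p.2 - p.1.2) => A0.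
have : 0 <= t * (m * (1 - m) * A) by rewrite !mulr_ge0 //; lra.
have : 0 < m * (p.1.1 - t * r2) by rewrite mulr_gt0 // subr_gt0.
have : 0 <= m * (t * sqn p.2) by rewrite !mulr_ge0 // ltW.
have : 0 <= m * (t * (r2 - sqn p.1.2)) by rewrite !mulr_ge0 ?subr_ge0 // ltW.
by move: (m * (1 - m) * A) => A'; nra.
Qed.

Hypothesis r2_ge0 : 0 <= r2.
Hypothesis G_ge : forall q j, sqn (X q) - sqn (X j) <= G.
Hypothesis G_ge0 : 0 <= G.
Hypothesis centers_le : forall Q y, empty_center Q y ->
  exists y', empty_center Q y' /\ sqn y' <= r2.
Hypothesis cech_le : forall Q, in_cech Q ->
  exists z, sqn z <= r2 /\ forall q, q \in Q -> sqn (z - X q) <= s2.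

Lemma feasible_exists Q : in_cech Q -> exists p, feasible Q p.
Proof.
(* At y = 0 the constraints compare squared norms of the points, which [G] bounds. *)
move=> /cech_le[z [zr zQ]]; exists (G, z, 0); split=> /=; rewrite ?lexx ?G_ge0 //.
- by split=> //; rewrite /sqn /dotv big1 // => l _; rewrite mxE mul0r.
- by move=> q j _; rewrite !sub0r !sqnN.
Qed.

Lemma feasible_cech Q p : feasible Q p -> in_cech Q.
Proof. by case=> _ _ h _; exists p.1.2. Qed.

(** By compactness gamma has a positive minimum on each feasible set without empty centre, and there
    are finitely many [Q]. As 2 r2 bounds the quadratic term, this [t] keeps Delaunay and
    non-Delaunay optima apart. *)
Lemma gap_exists : exists2 t, 0 < t & forall Q p, feasible Q p ->
  ~ (exists y, empty_center Q y) -> 2 * t * r2 < p.1.1.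
Proof.
have /choice[g gP] : forall Q, exists g, 0 < g /\ forall p, feasible Q p ->
    ~ (exists y, empty_center Q y) -> g <= p.1.1.
  move=> Q; have [[[p0 fp0] nD]|h] :=
      pselect ((exists p, feasible Q p) /\ ~ exists y, empty_center Q y); last first.
    by exists 1; split=> // p fp nD; case: h; split=> //; exists p.
  have [p [fp pmin]] := optimal_exists 0 fp0; exists p.1.1; split; last first.
    by move=> p' /pmin; rewrite /objective !mul0r !addr0.
  have [/andP[g0 _] _ _ yQ] := fp; rewrite lt_def g0 andbT.
  apply/eqP => e; apply: nD; exists p.2 => q j qQ.
  by rewrite -subr_le0 -e yQ.
pose g0 := \big[Num.min/1]_Q g Q.
have g00 : 0 < g0 by apply/lt_bigmin => //; move=> Q _; case: (gP Q).
have r21 : 0 < 2 * r2 + 1 by have := r2_ge0; lra.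
(* The added 1 covers r2 = 0. *)
exists (g0 / (2 * r2 + 1)); first exact: divr_gt0.
move=> Q p fp nD; apply: lt_le_trans ((gP Q).2 _ fp nD).
have g0Q : g0 <= g Q by apply: bigmin_le.
apply: lt_le_trans g0Q; rewrite mulrA mulrAC ltr_pdivrMr //; nra.
Qed.


Lemma toggleable_of_bounds :
  toggleable (fun Q => (Q != set0 /\ in_cech Q) /\ ~ delaunay X Q).
Proof.
case=> Q1 [[/set0Pn[i0 _] _] _].
have [t t0 gap] := gap_exists.
have /choice[m mP] : forall Q, exists p, in_cech Q -> optimal t Q p.
  move=> Q; have [/feasible_exists[p0 fp0]|nQ] := pselect (in_cech Q).
    by have [p op] := optimal_exists t fp0; exists p.
  by exists (0, 0, 0).
(* The vertex is chosen from [p] alone, so simplices with the same optimum toggle the same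
   vertex. *)
have /choice[g gP] : forall p, exists x, (exists x', near_point p x') ->
    near_point p x.
  move=> p; have [[x' px]|np] := pselect (exists x', near_point p x').
    by exists x'.
  by exists i0.
pose S Q := (Q != set0 /\ in_cech Q) /\ ~ delaunay X Q.
have Sm Q : S Q -> [/\ optimal t Q (m Q), 2 * t * r2 < (m Q).1.1 &
    near_point (m Q) (g (m Q))].
  move=> [[Q0 cQ] nD]; have oQ := mP _ cQ.
  have lt : 2 * t * r2 < (m Q).1.1.
    by apply: (gap Q); [case: oQ|move=> D; apply: nD; apply/delaunay_center].
  split=> //; apply: gP; apply: (near_point_exists t0 Q0 oQ).
  have : 0 <= t * r2 by rewrite mulr_ge0 // ltW.
  by move: lt; rewrite -mulrA; lra.
have mono Q Q' : S Q -> S Q' -> Q \subset Q' ->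
    objective t (m Q) <= objective t (m Q') /\
    (objective t (m Q') <= objective t (m Q) -> m Q = m Q').
  move=> /Sm[oQ _ _] /Sm[[fQ' _] _ _] QQ.
  have fQ := feasibleS QQ fQ'; split; first exact: oQ.2.
  exact: (optimal_unique t0 oQ fQ).
(* Rank of the optimal value among all vertex sets: a natural number that orders them as the real
   values do. *)
pose lev Q := #|[set Q' | objective t (m Q') < objective t (m Q)]|.
have lev_le Q Q' : objective t (m Q) <= objective t (m Q') -> (lev Q <= lev Q')%N.
  move=> le; apply: subset_leq_card; apply/subsetP => U; rewrite !inE => lt.
  exact: lt_le_trans lt le.
have lev_lt Q Q' : objective t (m Q) < objective t (m Q') -> (lev Q < lev Q')%N.
  move=> lt; apply: proper_card; apply/properP; split.
    by apply/subsetP => U; rewrite !inE => lt'; apply: lt_trans lt' lt.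
  by exists Q; rewrite !inE ?ltxx.
have togU Q : S Q -> S (g (m Q) |: Q) /\ m (g (m Q) |: Q) = m Q.
  move=> SQ; have [oQ gam [near zx]] := Sm _ SQ; set x := g (m Q) in near zx *.
  have [fQ Qmin] := oQ; have [h1 h2 zQ yQ] := fQ.
  have [[Q0 cQ] nD] := SQ.
  have r2t : 0 <= 2 * t * r2 by rewrite !mulr_ge0 // ltW.
  have fU : feasible (x |: Q) (m Q).
    split=> // [q|q j]; rewrite !inE => /orP[/eqP ->|qQ].
    - exact: ltW.
    - exact: zQ.
    - by have := near j; lra.
    - exact: yQ.
  have SU : S (x |: Q).
    split; first split; last 1 first.
    - move=> /delaunay_center[_ [y yU]]; apply: nD; apply/delaunay_center.
      by split=> //; exists y => q j qQ; apply: yU; rewrite !inE qQ orbT.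
    - by apply/set0Pn; exists x; rewrite !inE eqxx.
    - exact: feasible_cech fU.
  split=> //; have [_ h] := mono _ _ SQ SU (subsetUr _ _).
  by apply/esym/h; have [[_ ->]] := Sm _ SU.
have togD Q : S Q -> S (Q :\ g (m Q)) /\ m (Q :\ g (m Q)) = m Q.
  move=> SQ; have [oQ gam [near zx]] := Sm _ SQ; set x := g (m Q) in near zx *.
  have [fQ Qmin] := oQ; have [h1 h2 zQ yQ] := fQ.
  have [[Q0 cQ] nD] := SQ.
  have r2t : 0 <= 2 * t * r2 by rewrite !mulr_ge0 // ltW.
  have fD : feasible (Q :\ x) (m Q) := feasibleS (subD1set _ _) fQ.
  have oD := mP _ (feasible_cech fD); have [fm mmin] := oD.
  set p := m (Q :\ x) in oD fm mmin *.
  (* The constraints of [x] are slack at [m Q], so a short step from [m Q] towards [p] stays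
     feasible for [Q]. By convexity dropping [x] cannot lower the minimum, and uniqueness
     concludes. *)
  have mE : p = m Q.
    apply: (optimal_unique t0 oD fD).
    have [a1 a101 ha1] := small_weight (sqn (p.1.2 - X x)) s2 zx.
    have [a2 a201 ha2] := @small_weight 0 (sqn (p.2 - X x)) (m Q).1.1 0 ltac:(lra).
    pose a := Num.min a1 a2.
    have aa1 : 0 <= a <= a1.
      by rewrite /a le_min ge_min lexx; case/andP: a101 a201 => /ltW -> _ /andP[/ltW ->].
    have aa2 : 0 <= a <= a2.
      by rewrite /a le_min ge_min lexx orbT; case/andP: a101 a201 => /ltW -> _ /andP[/ltW ->].
    have a0 : 0 < a by rewrite /a lt_min; case/andP: a101 a201 => -> _ /andP[->].
    have a01 : 0 <= a <= 1.
      by case/andP: aa1 => -> /le_trans; apply; case/andP: a101.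
    have [g1 [g2 g3] zD yD] := feasible_comb a01 fD fm.
    have fc : feasible Q (comb a (m Q) p).
      split=> // [q qQ|q j qQ]; have [->|qx] := eqVneq q x.
      - by apply: sqn_segment_le => //; have := ha1 _ aa1; lra.
      - by apply: zD; rewrite !inE qx.
      - rewrite sqn_segment_diff; have := ha2 _ aa2; have := near j.
        have := sqn_ge0 (p.2 - X j); have [/andP[p0 _] _ _ _] := fm.
        by case/andP: a01 => ? ? ? ? ?; rewrite /=; nra.
      - by apply: yD; rewrite !inE qx.
    have h : objective t (m Q) <= (1 - a) * objective t (m Q) + a * objective t p.
      apply: le_trans (Qmin _ fc) _; rewrite objective_comb gerBl.
      case/andP: a01 => ? ?; apply: mulr_ge0; last by rewrite addr_ge0 ?sqn_ge0.
      by apply: mulr_ge0; [exact: ltW|rewrite mulr_ge0 ?subr_ge0].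
    have h' : 0 <= a * (objective t p - objective t (m Q)).
      by move: (objective t p) (objective t (m Q)) h => U V; lra.
    by rewrite -subr_ge0 -(pmulr_rge0 _ a0).
  split=> //; rewrite -/p; split; last first.
    (* A Delaunay [Q :\ x] would allow gamma = 0 and an objective of at most 2 t r2, below the
       gap. *)
    move=> /delaunay_center[_ [y0 /centers_le[y [yE yr]]]].
    have [z [zr zD]] := cech_le (feasible_cech fD).
    have fy : feasible (Q :\ x) (0, z, y).
      split=> //=; rewrite ?lexx ?G_ge0 // => q j qD.
      by rewrite subr_le0; apply: yE.
    have := mmin _ fy; rewrite mE /objective /= add0r => h.
    have : t * (sqn y + sqn z) <= 2 * t * r2 by nra.
    have := sqn_ge0 (m Q).2; have := sqn_ge0 (m Q).1.2; nra.
  split; last exact: feasible_cech fD.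
  (* If nothing remained, [Q] would be a single point, which is its own empty centre. *)
  apply/eqP => D0; apply: nD; apply/delaunay_center; split=> //.
  exists (X x) => q j qQ; suff -> : q = x.
    by rewrite subrr /sqn /dotv big1 ?sqn_ge0 // => l _; rewrite mxE mul0r.
  apply/eqP; have : q \notin Q :\ x by rewrite D0 inE.
  by rewrite !inE qQ andbT negbK.
exists lev, (fun Q => g (m Q)); split=> [Q SQ|Q Q' SQ SQ' QQ].
  have [S1 e1] := togU _ SQ; have [S2 e2] := togD _ SQ.
  by split=> //; rewrite /lev ?e1 ?e2.
have [le h] := mono _ _ SQ SQ' QQ; split; first exact: lev_le.
move=> elev; congr g; apply: h; rewrite leNgt; apply/negP => /lev_lt.
by rewrite elev ltnn.
Qed.

End CechDelaunay.

Lemma cech_delaunay_toggleable (R : realType) (d n : nat) (X : 'I_n -> 'rV[R]_d)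
    (s2 : R) :
  toggleable (fun Q => (Q != set0 /\ in_cech X s2 Q) /\ ~ delaunay X Q).
Proof.
have /choice[y yP] : forall Q, exists y, (exists y', empty_center X Q y') -> empty_center X Q y.
  move=> Q; have [[y hy]|h] := pselect (exists y, empty_center X Q y);
    by [exists y|exists 0].
have /choice[z zP] : forall Q, exists z, in_cech X s2 Q ->
    forall q, q \in Q -> sqn (z - X q) <= s2.
  move=> Q; have [[z hz]|h] := pselect (in_cech X s2 Q); by [exists z|exists 0].
pose r2 := \sum_Q sqn (y Q) + \sum_Q sqn (z Q).
have sy Q : sqn (y Q) <= \sum_Q sqn (y Q).
  by rewrite (bigD1 Q) //= lerDl; apply: sumr_ge0 => U _; apply: sqn_ge0.
have sz Q : sqn (z Q) <= \sum_Q sqn (z Q).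
  by rewrite (bigD1 Q) //= lerDl; apply: sumr_ge0 => U _; apply: sqn_ge0.
apply: (@toggleable_of_bounds _ _ _ _ _ r2 (\sum_i sqn (X i))).
- by rewrite addr_ge0 // sumr_ge0 // => U _; apply: sqn_ge0.
- move=> q j; rewrite (bigD1 q) //= lerD2l.
  rewrite (@le_trans _ _ 0) // ?oppr_le0 ?sqn_ge0 //.
  by apply: sumr_ge0 => U _; apply: sqn_ge0.
- by apply: sumr_ge0 => U _; apply: sqn_ge0.
- move=> Q y' hy; exists (y Q); split; first by apply: yP; exists y'.
  by have := sy Q; have := sqn_ge0 (z Q); have := sz Q; rewrite /r2; lra.
- move=> Q cQ; exists (z Q); split; last exact: zP.
  by have := sz Q; have := sqn_ge0 (y Q); have := sy Q; rewrite /r2; lra.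
Qed.
(** * Jung's theorem *)

Section Jung.
Import numFieldNormedType.Exports.
Variables (R : realType) (d n : nat) (X : 'I_n -> 'rV[R]_d) (Q : {set 'I_n}).
Implicit Types (a : 'rV[R]_n).

Definition weights := [set a : 'rV[R]_n |
  (forall i, 0 <= a 0 i <= 1) /\ \sum_(i in Q) a 0 i = 1]%classic.
Definition barycenter a := \sum_(i in Q) a 0 i *: X i.
(** Objective of the dual of the smallest enclosing ball problem: a maximiser yields the centre as
    barycentre, and its value bounds the squared radius. *)
Definition variance a :=
  \sum_(i in Q) a 0 i * sqn (X i) - sqn (barycenter a).

Lemma max_variance : Q != set0 ->
  exists2 a, weights a & forall b, weights b -> variance b <= variance a.
Proof.
move=> /set0Pn[i0 i0Q].
have ccoord i : continuous (fun a : 'rV[R]_n => a 0 i).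
  by move=> a; apply: coord_continuous.
have csum (f : 'I_n -> R) : continuous (fun a : 'rV[R]_n => \sum_(i in Q) a 0 i * f i).
  apply: continuous_big => [|i _ a]; first exact: add_continuous.
  exact: (cvgM (ccoord i a) (cvg_cst _)).
have cW : compact weights.
  apply: subclosed_compact (@sqn_ball_compact R n n%:R) _; last first.
    move=> a [h _] /=; rewrite /sqn /dotv -[n in n%:R]card_ord -sumr_const.
    by apply: ler_sum => i _; have /andP[? ?] := h i; nra.
  have -> : weights = (\bigcap_i ([set a | 0 <= a 0 i] `&` [set a | a 0 i <= 1])
      `&` ([set a | \sum_(i in Q) a 0 i * 1 <= 1]
      `&` [set a | 1 <= \sum_(i in Q) a 0 i * 1]))%classic.
    apply/seteqP; split=> a [h1 h2]; split.
    - by move=> i _; have /andP := h1 i.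
    - by rewrite /=; under eq_bigr do rewrite mulr1; rewrite h2.
    - by move=> i; apply/andP/(h1 i).
    - apply/eqP; rewrite eq_le; apply/andP; move: h2; rewrite /=.
      by under eq_bigr do rewrite mulr1.
  have c1 : continuous (fun a : 'rV[R]_n => 1 : R) by exact: cst_continuous.
  have c0 : continuous (fun a : 'rV[R]_n => 0 : R) by exact: cst_continuous.
  apply: closedI.
    apply: closed_bigI => i _; apply: closedI;
      apply: closed_le_fun; solve [exact: c0 | exact: c1 | exact: ccoord].
  apply: closedI; apply: closed_le_fun; solve [exact: c1 | exact: (csum (fun=> 1))].
have cvar : continuous variance.
  have cbar : continuous barycenter.
    apply: continuous_big => [|i _ b]; first exact: add_continuous.
    exact: (cvgZr_tmp (a := X i) (ccoord i b)).
  have cs : continuous (fun a => sqn (barycenter a)).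
    have -> : (fun a => sqn (barycenter a)) = (fun a => sqn (barycenter a - 0)).
      by apply/funext => a; rewrite subr0.
    exact: sqn_continuous.
  move=> a; exact: (cvgB (csum (fun i => sqn (X i)) a) (cs a)).
have W0 : (weights !=set0)%classic.
  exists (delta_mx 0 i0); split=> [i|].
    by rewrite mxE eqxx /=; case: eqP; rewrite lexx ler01.
  rewrite (bigD1 i0) //= mxE !eqxx big1 ?addr0 // => i /andP[_ ne].
  by rewrite mxE (negPf ne) andbF.
have [a aW amax] := compact_EVT_max W0 cW (continuous_subspaceT cvar).
exists a; first exact: set_mem aW.
by move=> b bW; apply: amax; apply/mem_set.
Qed.

(** First-order condition: moving a weight t to [q] cannot raise the variance, which gives (1 - t) s
    <= variance for the squared distance s to [q]; then t tends to 0. *)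
Lemma sqn_barycenter a : weights a -> forall q, q \in Q ->
  (forall b, weights b -> variance b <= variance a) ->
  sqn (barycenter a - X q) <= variance a.
Proof.
move=> [a01 asum] q qQ amax.
pose b t := (1 - t) *: a + t *: delta_mx 0 q.
have bE t i : b t 0 i = (1 - t) * a 0 i + t * (i == q)%:R.
  by rewrite !mxE eqxx.
have dsum (V : lmodType R) (f : 'I_n -> V) : \sum_(i in Q) (i == q)%:R *: f i = f q.
  rewrite (bigD1 q) //= eqxx scale1r big1 ?addr0 // => i /andP[_ /negPf ->].
  by rewrite scale0r.
have bW t : 0 <= t <= 1 -> weights (b t).
  move=> /andP[t0 t1]; split=> [i|].
    rewrite bE; have /andP[? ?] := a01 i.
    by case: (i == q); apply/andP; split; rewrite /=; nra.
  under eq_bigr do rewrite bE; rewrite big_split /= -!mulr_sumr asum.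
  have := dsum R^o (fun=> 1); under eq_bigr do rewrite /GRing.scale /= mulr1.
  by move=> ->; ring.
have bz t : barycenter (b t) = segment t (barycenter a) (X q).
  rewrite /barycenter /segment !scaler_sumr -(dsum _ X) scaler_sumr -big_split.
  by apply: eq_bigr => i _; rewrite /= bE !scalerA -scalerDl.
have bs t : \sum_(i in Q) b t 0 i * sqn (X i) =
    (1 - t) * (\sum_(i in Q) a 0 i * sqn (X i)) + t * sqn (X q).
  rewrite mulr_sumr -(dsum R^o (fun i => sqn (X i))) mulr_sumr -big_split.
  by apply: eq_bigr => i _; rewrite /= bE mulrDl !mulrA.
set s := sqn _; have s0 : 0 <= s := sqn_ge0 _.
have key t : 0 < t <= 1 -> (1 - t) * s <= variance a.
  move=> /andP[t0 t1]; have := amax _ (bW t _); rewrite (ltW t0) t1 => /(_ isT).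
  rewrite {1}/variance bs bz sqn_segment -/s /variance.
  set A := \sum_(i in Q) _; set B := sqn (barycenter a); set C := sqn (X q).
  move=> h; rewrite -(ler_pM2l t0); lra.
rewrite leNgt; apply/negP => lt.
have v0 : 0 <= variance a by have := key 1; rewrite subrr mul0r; apply; lra.
(* With this [t], (1 - t) s is the mean of s and the variance, hence still too large. *)
pose t := (s - variance a) / (2 * s).
have s1 : 0 < s by lra.
have ht : t * (2 * s) = s - variance a by rewrite /t divfK // mulf_neq0 // gt_eqF.
have t0 : 0 < t by rewrite divr_gt0 ?subr_gt0 // mulr_gt0.
have t1 : t <= 1 by rewrite ler_pdivrMr ?mulr_gt0 //; lra.
by have := key t; rewrite t0 t1 => /(_ isT); lra.
Qed.

Lemma variance_double a : weights a ->
  \sum_(i in Q) \sum_(j in Q) a 0 i * a 0 j * sqn (X i - X j) = 2 * variance a.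
Proof.
move=> [_ asum]; set z := barycenter a.
pose A := \sum_(i in Q) a 0 i * sqn (X i).
have dz v : \sum_(j in Q) a 0 j * dotv v (X j) = dotv v z.
  rewrite /z /barycenter; elim/big_rec2: _ => [|j y x _ ->].
    by rewrite /dotv big1 // => l _; rewrite mxE mulr0.
  by rewrite dotvDr dotvZr.
have inner i : \sum_(j in Q) a 0 i * a 0 j * sqn (X i - X j) =
    a 0 i * sqn (X i) - 2 * (a 0 i * dotv z (X i)) + a 0 i * A.
  have e1 : a 0 i * sqn (X i) = \sum_(j in Q) a 0 i * sqn (X i) * a 0 j.
    by rewrite -mulr_sumr asum mulr1.
  have e2 : 2 * (a 0 i * dotv z (X i)) =
      \sum_(j in Q) 2 * (a 0 i * (a 0 j * dotv (X i) (X j))).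
    by rewrite -!mulr_sumr dz dotvC.
  have e3 : a 0 i * A = \sum_(j in Q) a 0 i * (a 0 j * sqn (X j)).
    by rewrite -mulr_sumr.
  rewrite e1 e2 e3 -sumrB -big_split /=; apply: eq_bigr => j _.
  by rewrite /sqn !dotvE (dotvC (X j) (X i)); ring.
under eq_bigr do rewrite inner.
rewrite big_split sumrB /= -mulr_sumr dz -mulr_suml asum /variance -/z -/A.
by rewrite -/(sqn z); ring.
Qed.

(** In the double sum for the variance the diagonal vanishes, leaving total weight 1 - sum a_i^2 <=
    N / (N + 1) at squared distances of at most 4 r^2. This is where the constant originates. *)
Lemma jung (N : nat) (r : R) : Q != set0 -> (#|Q| <= N.+1)%N ->
  (forall i j, i \in Q -> j \in Q -> sqn (X i - X j) <= 4 * r ^+ 2) ->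
  exists z, forall q, q \in Q -> sqn (z - X q) <= (cDR R N * r) ^+ 2.
Proof.
move=> Q0 cQ Qr; have [a aW amax] := max_variance Q0.
exists (barycenter a) => q qQ.
apply: le_trans (sqn_barycenter aW qQ amax) _.
have N0 : 0 < N%:R + 1 :> R by rewrite ltr_wpDl.
rewrite exprMn sqr_sqrtr; last by rewrite divr_ge0 ?mulr_ge0 // ltW.
have [a01 asum] := aW.
have Q0r : Q != set0 := Q0.
have a0 i : 0 <= a 0 i by case/andP: (a01 i).
have dbl := variance_double aW.
have s2 : 1 / (N%:R + 1) <= \sum_(i in Q) a 0 i ^+ 2.
  (* Cauchy-Schwarz, as a square around the uniform weight on N + 1 points. *)
  have : 0 <= \sum_(i in Q) (a 0 i - 1 / (N%:R + 1)) ^+ 2.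
    by apply: sumr_ge0 => i _; apply: sqr_ge0.
  have -> : \sum_(i in Q) (a 0 i - 1 / (N%:R + 1)) ^+ 2 =
     \sum_(i in Q) a 0 i ^+ 2 - 2 / (N%:R + 1) * (\sum_(i in Q) a 0 i)
     + \sum_(i in Q) (1 / (N%:R + 1)) ^+ 2.
    by rewrite mulr_sumr -sumrB -big_split; apply: eq_bigr => i _ /=; ring.
  rewrite asum sumr_const -mulr_natr.
  have : #|Q|%:R <= N%:R + 1 :> R by rewrite natr1 ler_nat.
  set M := N%:R + 1 in N0 *; set c := #|Q|%:R => cM.
  have : (1 / M) ^+ 2 * c <= 1 / M.
    rewrite expr2 -mulrA -[leRHS]mulr1 ler_wpM2l ?divr_ge0 ?(ltW N0) //.
    by rewrite mulrC mulrA mulr1 ler_pdivrMr // mul1r.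
  by rewrite mulr1; set S := \sum_(i in Q) _; lra.
have : 2 * variance a <= 4 * r ^+ 2 * (1 - \sum_(i in Q) a 0 i ^+ 2).
  rewrite -dbl.
  have -> : 4 * r ^+ 2 * (1 - \sum_(i in Q) a 0 i ^+ 2) =
     \sum_(i in Q) \sum_(j in Q) a 0 i * a 0 j * (4 * r ^+ 2 * (j != i)%:R).
    have e1 : \sum_(i in Q) \sum_(j in Q) a 0 i * a 0 j = 1.
      by under eq_bigr do rewrite -mulr_sumr asum mulr1.
    transitivity (4 * r ^+ 2 * (\sum_(i in Q) \sum_(j in Q) a 0 i * a 0 j
      - \sum_(i in Q) a 0 i ^+ 2)); first by rewrite e1.
    rewrite -sumrB mulr_sumr; apply: eq_bigr => i iQ.
    rewrite (bigD1 i) //= [RHS](bigD1 i) //= eqxx /= !mulr0 add0r.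
    rewrite expr2 addrAC subrr add0r mulr_sumr; apply: eq_bigr => j /andP[_ ji].
    by rewrite ji mulr1 mulrC.
  apply: ler_sum => i iQ; apply: ler_sum => j jQ.
  rewrite ler_wpM2l ?mulr_ge0 //; case: eqVneq => [->|_]; last first.
    by rewrite mulr1; apply: Qr.
  by rewrite subrr mulr0 /sqn /dotv big1 // => l _; rewrite mxE mul0r.
have r0 : 0 <= r ^+ 2 by apply: sqr_ge0.
have -> : 2 * N%:R / (N%:R + 1) = 2 * (1 - 1 / (N%:R + 1)) :> R.
  by field; rewrite gt_eqF.
move: (\sum_(i in Q) _) (1 / _) s2 => S i Si; nra.
Qed.

End Jung.
(** * Persistence diagrams and induced matchings *)

Section GreedyMatching.
Variables (T K : eqType) (J : Type) (key : T -> K) (le : rel T).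
Hypotheses (le_total : total le) (le_trans : transitive le).

Lemma max_of_key (s : seq T) x : x \in s -> exists y,
  [/\ y \in s, key y = key x & forall z, z \in s -> key z = key x -> le z y].
Proof.
have le_refl z : le z z by have := le_total z z; rewrite orbb.
suff h : (forall y, y \in s -> key y <> key x) \/ exists y,
    [/\ y \in s, key y = key x & forall z, z \in s -> key z = key x -> le z y].
  by move=> xs; case: h => // /(_ _ xs).
elim: s => [|a s IH]; first by left.
have [ax|ax] := eqVneq (key a) (key x); last first.
  case: IH => [IH|[y [ys yx ymax]]]; [left|right].
    by move=> y; rewrite in_cons => /predU1P[->|/IH//]; apply/eqP.
  exists y; rewrite in_cons ys orbT; split=> // z; rewrite in_cons.
  by case/predU1P => [->|/ymax//] /eqP; rewrite (negPf ax).
right; case: IH => [IH|[y [ys yx ymax]]].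
  exists a; rewrite mem_head; split=> // z; rewrite in_cons.
  by case/predU1P => [->//|/IH].
have [ay|ya] := boolP (le a y).
  exists y; rewrite in_cons ys orbT; split=> // z; rewrite in_cons.
  by case/predU1P => [->//|/ymax].
have {}ya : le y a by have := le_total a y; rewrite (negPf ya).
exists a; rewrite mem_head; split=> // z; rewrite in_cons.
by case/predU1P => [->//|zs zx]; apply: le_trans ya; apply: ymax.
Qed.

Variables A A' : J -> pred T.
Hypothesis A_key : forall j a b, A j a -> A j b -> key a = key b.
Hypothesis A_up : forall j a b, key a = key b -> le a b -> A j a -> A j b.
Hypothesis A'_up : forall j a b, key a = key b -> le a b -> A' j a -> A' j b.
Hypothesis A'A : forall j a, A' j a -> A j a.

(** Within each key the elements are matched from the largest down. Every [A j] and [A' j] is an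
    upper set inside one key, so its count says how far down it reaches. *)
Lemma greedy_matching (U V : seq T) :
  (forall u, u \in U -> exists j, A j u) ->
  (forall j, count (A j) U <= count (A j) V)%N ->
  (forall j, count (A' j) V <= count (A j) U)%N ->
  exists (M : seq (T * T)) rest,
    [/\ perm_eq U (unzip1 M), perm_eq V (unzip2 M ++ rest),
     forall u v, (u, v) \in M -> [/\ key u = key v,
       forall j, A j u -> A j v & forall j, A' j v -> A j u] &
     forall v j, v \in rest -> ~~ A' j v].
Proof.
have [N] := ubnP (size U); elim: N U V => // N IH [|u0 U] V.
  move=> _ _ _ h; exists [::], V; split=> // v j vV; apply/negP => vA.
  have := h j; rewrite /= leqn0 -[_ == 0%N]negbK -lt0n -has_count => /negP; apply.
  by apply/hasP; exists v.
move=> szU inA UV VU.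
have [u [uU uu0 umax']] := max_of_key (mem_head u0 U).
have umax z : z \in u0 :: U -> key z = key u -> le z u.
  by rewrite uu0; apply: umax'.
have countP (s : seq T) (a : pred T) : (0 < count a s)%N ->
    exists2 x, x \in s & a x by rewrite -has_count => /hasP.
have [j0 uA] := inA _ uU.
have countU j x : x \in u0 :: U -> A j x -> (0 < count (A j) (u0 :: U))%N.
  by move=> xU xA; rewrite -has_count; apply/hasP; exists x.
have [v1 v1V v1A] := countP _ _ (leq_trans (countU _ _ uU uA) (UV j0)).
have [v [vV vk vmax']] := max_of_key v1V.
have {}vk : key v = key u by rewrite vk (A_key v1A uA).
have vmax z : z \in V -> key z = key u -> le z v.
  by rewrite -(A_key v1A uA); apply: vmax'.
set W := u0 :: U in uU umax UV VU inA countU szU *.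
have AuV j : A j u -> A j v.
  move=> ujA; have [w wV wA] := countP _ _ (leq_trans (countU _ _ uU ujA) (UV j)).
  have kw := A_key wA ujA; apply: A_up wA; rewrite ?vk //; exact: vmax.
have A'vU j : A' j v -> A j u.
  move=> vA'; have cV : (0 < count (A' j) V)%N.
    by rewrite -has_count; apply/hasP; exists v.
  have [w wU wA] := countP _ _ (leq_trans cV (VU j)).
  have kw : key w = key u by rewrite -vk; apply: A_key wA (A'A vA').
  by apply: A_up wA => //; apply: umax.
have cU a : count a W = (a u + count a (rem u W))%N.
  by rewrite (permP (perm_to_rem uU)).
have cV a : count a V = (a v + count a (rem v V))%N.
  by rewrite (permP (perm_to_rem vV)).
have zero (a : pred T) (s : seq T) : (forall x, x \in s -> a x -> False) -> count a s = 0%N.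
  move=> h; apply/eqP; rewrite -leqn0 leqNgt; apply/negP => /countP[x xs].
  exact: h xs.
(* Removing the two maxima preserves the count inequalities: either both sides lose one, or the
   smaller side has no member at all because its maximum is none. *)
have [||j|j|M [rest [pU pV good bad]]] := IH (rem u W) (rem v V).
- by rewrite size_rem // -ltnS; apply: leq_trans szU; rewrite ltnS prednK.
- by move=> x /mem_rem; apply: inA.
- have := UV j; rewrite cU cV; have [/AuV ->|uA'] := boolP (A j u).
    by rewrite leq_add2l.
  case: (boolP (A j v)) => // vA _; rewrite zero // => x /mem_rem xU xA.
  case/negP: uA'; have kx : key x = key u by rewrite -vk; apply: A_key xA vA.
  by apply: A_up xA => //; apply: umax.
- have := VU j; rewrite cU cV; have [/[dup] vA' /A'vU ->|vA'] := boolP (A' j v).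
    by rewrite leq_add2l.
  case: (boolP (A j u)) => // ujA _; rewrite zero // => x /mem_rem xV xA.
  case/negP: vA'; have kx := A_key (A'A xA) ujA.
  by apply: A'_up xA; rewrite ?vk //; apply: vmax.
exists ((u, v) :: M), rest; split=> //.
- by rewrite /= (perm_trans (perm_to_rem uU)) // perm_cons.
- by rewrite /= (perm_trans (perm_to_rem vV)) // perm_cons.
- by move=> x y; rewrite in_cons => /predU1P[[-> ->]|/good//]; split.
Qed.

End GreedyMatching.

(** * Diagrams as Moebius inverses of rank functions *)

Section GridDiagram.
Variables (R : realType) (g : seq R).
Local Notation N := (size g).

Definition grid_dgm (B : nat -> nat -> nat) : seq (R * option R) :=
  let Bm i j := if i is i'.+1 then B i' j else 0%N in
  flatten [seq flatten
      [seq nseq ((B i j.-1 - B i j) - (Bm i j.-1 - Bm i j))%N (g`_i, Some g`_j)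
      | j <- iota i.+1 (N - i.+1)] | i <- iota 0 N]
  ++ flatten [seq nseq (B i N.-1 - Bm i N.-1)%N (g`_i, None) | i <- iota 0 N].

Definition dies_after (t : R) (u : option R) := if u is Some y then t < y else true.

Definition alive (s t : R) (p : R * option R) := (p.1 <= s) && dies_after t p.2.

Lemma count_flatten_map (T : Type) (a : pred T) (f : nat -> seq T) s :
  count a (flatten [seq f i | i <- s]) = (\sum_(i <- s) count a (f i))%N.
Proof. by rewrite count_flatten -map_comp sumnE big_map. Qed.

Lemma sum_decr (A : nat -> nat) c M : (c <= M)%N ->
  (forall j, (c <= j < M)%N -> (A j.+1 <= A j)%N) ->
  (\sum_(c.+1 <= j < M.+1) (A j.-1 - A j) + A M = A c)%N.
Proof.
elim: M => [|M IH] cM mono; first by rewrite leqn0 in cM; rewrite (eqP cM) big_geq.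
move: cM; rewrite leq_eqVlt => /predU1P[->|cM]; first by rewrite big_geq.
rewrite big_nat_recr //= -IH //; first by have := mono M; rewrite -ltnS cM ltnSn => /(_ isT); lia.
by move=> j /andP[cj jM]; apply: mono; rewrite cj ltnW.
Qed.

Hypothesis g_sorted : sorted <%R g.
Variable B : nat -> nat -> nat.
Let Bm i j := if i is i'.+1 then B i' j else 0%N.
Hypothesis B_mono : forall i j, (i <= j < N)%N -> (Bm i j <= B i j)%N.
Hypothesis B_Frob : forall i j, (i <= j)%N -> (j.+1 < N)%N ->
  (B i j.+1 + Bm i j <= B i j + Bm i j.+1)%N.
Hypothesis B_anti : forall i j, (i <= j)%N -> (j.+1 < N)%N ->
  (B i j.+1 <= B i j)%N.

Let Bm_anti i j : (i <= j)%N -> (j.+1 < N)%N -> (Bm i j.+1 <= Bm i j)%N.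
Proof. by case: i => // i ij; apply: B_anti; apply: ltnW. Qed.

Let le_g i j : (i < N)%N -> (j < N)%N -> (g`_i <= g`_j) = (i <= j)%N.
Proof. by move=> iN jN; rewrite lt_sorted_leq_nth. Qed.

Let lt_g i j : (i < N)%N -> (j < N)%N -> (g`_i < g`_j) = (i < j)%N.
Proof. by move=> iN jN; rewrite lt_sorted_ltn_nth. Qed.

(** Monotonicity and the Frobenius inequality make the truncated subtractions exact, so the sum
    telescopes over deaths and then over births. *)
Lemma count_grid_dgm a c : (a <= c)%N -> (c < N)%N ->
  count (alive g`_a g`_c) (grid_dgm B) = B a c.
Proof.
move=> ac cN; rewrite /grid_dgm count_cat !count_flatten_map -big_split /=.
(* The number of bars born at index [i] that outlive index [j]. *)
pose A i j := (B i j - Bm i j)%N.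
transitivity (\sum_(i <- iota 0 N) (if (i <= a)%N then A i c else 0))%N.
  rewrite big_seq_cond [RHS]big_seq_cond; apply: eq_bigr => i.
  rewrite andbT mem_iota /= add0n => iN.
  rewrite count_flatten_map count_nseq /alive /= (le_g iN (leq_ltn_trans ac cN)).
  rewrite andbT; case: ifPn => ia; last first.
    rewrite mul0n addn0 big1 // => j _; rewrite count_nseq /=.
    by rewrite (le_g iN (leq_ltn_trans ac cN)) (negPf ia).
  rewrite mul1n.
  have ic := leq_trans ia ac.
  transitivity (\sum_(c.+1 <= j < N) (A i j.-1 - A i j) + A i N.-1)%N; last first.
    rewrite -{1}(ltn_predK cN); apply: sum_decr; first by rewrite -ltnS (ltn_predK cN).
    move=> j /andP[cj jN]; have j1 : (j.+1 < N)%N by rewrite -(ltn_predK cN) ltnS.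
    have ij := leq_trans ic cj.
    have := B_Frob ij j1; have := B_mono (i := i) (j := j); have := B_mono (i := i) (j := j.+1).
    rewrite ij leqW // (ltnW j1) j1 /A => /(_ isT) ? /(_ isT) ?; lia.
  congr addn; rewrite -/(index_iota _ _) (big_cat_nat (n := c.+1)) //=.
  rewrite big_nat_cond big1 ?add0n => [|j /andP[/andP[ij jc] _]]; last first.
    have jN := leq_ltn_trans (jc : (j <= c)%N) cN; rewrite count_nseq /= lt_g //.
    by rewrite ltnNge -ltnS jc andbF mul0n.
  rewrite big_nat_cond [RHS]big_nat_cond; apply: eq_bigr => j /andP[/andP[cj jN] _].
  rewrite count_nseq /= lt_g // cj (le_g iN (leq_ltn_trans ac cN)) ia mul1n.
  have jj := ltn_predK cj.
  have ij : (i <= j.-1)%N by rewrite -ltnS jj (leq_ltn_trans ic).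
  have := B_Frob ij; rewrite jj => /(_ jN); have := B_anti ij; rewrite jj => /(_ jN).
  have := Bm_anti ij; rewrite jj => /(_ jN).
  have := B_mono (i := i) (j := j.-1); have := B_mono (i := i) (j := j).
  have jN1 : (j.-1 < N)%N by rewrite -ltnS jj ltnW.
  rewrite ij jN jN1 (leq_trans ij (leq_pred _)) /A => /(_ isT) ? /(_ isT) ?.
  by rewrite -/(Bm _ _) -/(Bm _ _); lia.
have aN := leq_ltn_trans ac cN.
have -> : iota 0 N = index_iota 0 N by rewrite /index_iota subn0.
rewrite (big_cat_nat (n := a.+1)) //=.
rewrite [X in (_ + X)%N]big_nat_cond [X in (_ + X)%N]big1 ?addn0; last first.
  by move=> i /andP[/andP[ai _] _]; rewrite leqNgt ai.
rewrite big_nat_cond (eq_bigr (fun i => A i c)); last first.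
  by move=> i /andP[/andP[_ ia] _]; rewrite -ltnS ia.
rewrite -big_nat_cond.
elim: a ac {aN} => [|a IH] ac; first by rewrite big_nat1 /A subn0.
rewrite big_nat_recr // IH ?(ltnW ac) //= /A subnKC //.
by have := B_mono (i := a.+1) (j := c); rewrite ac cN; apply.
Qed.

Lemma mem_grid_dgm p : p \in grid_dgm B ->
  p.1 \in g /\ (if p.2 is Some y then p.1 < y /\ y \in g else True).
Proof.
rewrite mem_cat => /orP[]/flatten_mapP[i]; rewrite mem_iota add0n => /= iN.
  case/flatten_mapP => j; rewrite mem_iota subnKC // => /andP[ij jN].
  by case/nseqP => -> _ /=; rewrite !mem_nth // lt_g.
by case/nseqP => -> _; rewrite mem_nth.
Qed.

End GridDiagram.
Section RealGrid.
Variables (R : realType) (g : seq R) (b : R -> R -> nat).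
Hypothesis g_sorted : sorted <%R g.
Hypothesis b_zero : forall s t, s <= t -> {in g, forall x, s < x} -> b s t = 0%N.
Hypothesis b_const : forall s s' t t', s <= t -> s' <= t' ->
  {in g, forall x, (x <= s) = (x <= s')} ->
  {in g, forall x, (x <= t) = (x <= t')} -> b s t = b s' t'.
Hypothesis b_mono : forall s' s t, s' <= s -> s <= t -> (b s' t <= b s t)%N.
Hypothesis b_anti : forall s t t', s <= t -> t <= t' -> (b s t' <= b s t)%N.
Hypothesis b_Frob : forall s' s t t', s' <= s -> s <= t -> t <= t' ->
  (b s t' + b s' t <= b s t + b s' t')%N.
Local Notation N := (size g).

Definition dgm_of := grid_dgm g (fun i j => b g`_i g`_j).

Let le_g i j : (i < N)%N -> (j < N)%N -> (g`_i <= g`_j) = (i <= j)%N.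
Proof. by move=> iN jN; rewrite lt_sorted_leq_nth. Qed.

Lemma sorted_cutoff s : exists2 c, (c <= N)%N &
  forall i, (i < N)%N -> (g`_i <= s) = (i < c)%N.
Proof.
exists (find (fun x => s < x) g); first exact: find_size.
move=> i iN; apply/idP/idP => [gs|ic]; last first.
  by have := before_find 0 ic; rewrite ltNge => /negbFE.
rewrite ltnNge; apply/negP => ci; have cN := leq_ltn_trans ci iN.
have := nth_find 0 (a := fun x => s < x) (s := g); rewrite has_find cN => /(_ isT).
by apply/negP; rewrite -leNgt (le_trans _ gs) // le_g.
Qed.

(** Both sides change only at grid values, so s and t are rounded down to the grid; below the grid
    both are 0. *)
Lemma count_alive s t : s <= t -> count (alive s t) dgm_of = b s t.
Proof.
move=> st; have [a1 a1N sa] := sorted_cutoff s; have [c1 c1N tc] := sorted_cutoff t.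
case: a1 => [|a] in a1N sa *.
  rewrite b_zero //; last first.
    by move=> x xg; rewrite ltNge -(nth_index 0 xg) sa ?index_mem.
  apply/eqP; rewrite -leqn0 leqNgt -has_count; apply/hasPn => p.
  case/(mem_grid_dgm g_sorted) => pg _; rewrite /alive -(nth_index 0 pg).
  by rewrite sa ?index_mem.
have ac1 : (a < c1)%N by rewrite -tc // (le_trans _ st) // sa.
case: c1 => // c in c1N tc ac1 *.
have inS x : x \in g -> (x <= s) = (x <= g`_a).
  by move=> xg; rewrite -(nth_index 0 xg) sa ?index_mem // le_g ?index_mem.
have inT x : x \in g -> (x <= t) = (x <= g`_c).
  by move=> xg; rewrite -(nth_index 0 xg) tc ?index_mem // le_g ?index_mem.
have gac : g`_a <= g`_c by rewrite le_g.
rewrite (b_const st gac inS inT).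
transitivity (count (alive g`_a g`_c) dgm_of).
  apply: eq_in_count => p /(mem_grid_dgm g_sorted)[pg dg].
  rewrite /alive inS //; congr andb; case: (p.2) dg => //= y [_ yg].
  by rewrite !ltNge inT.
apply: (@count_grid_dgm _ g g_sorted (fun i j => b g`_i g`_j)) => //.
- move=> [|i] j // /andP[ij jN]; have iN := leq_ltn_trans ij jN.
  by apply: b_mono; rewrite le_g // ltnW.
- move=> [|i] j ij jN; have jN' := ltnW jN; have iN := leq_ltn_trans ij jN'.
    by rewrite !addn0; apply: b_anti; rewrite le_g.
  have iN' := ltnW iN; have ij' := ltnW ij.
  by apply: b_Frob; rewrite le_g.
- move=> i j ij jN; have jN' := ltnW jN; have iN := leq_ltn_trans ij jN'.
  by apply: b_anti; rewrite le_g.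
Qed.

Lemma mem_dgm_of p : p \in dgm_of ->
  p.1 \in g /\ (if p.2 is Some y then p.1 < y /\ y \in g else True).
Proof. exact: mem_grid_dgm. Qed.

End RealGrid.

(** * Matchings induced by an epimorphism and a monomorphism *)

Section InducedMatching.
Variable R : realType.
Implicit Types (D : seq (R * option R)) (p : R * option R).

(** Isolates a value in a finite list, so that the bars born or dying exactly there become a
    difference of two counts. *)
Lemma gap_below (l : seq R) y : exists2 s, s < y & {in l, forall x, x < y -> x <= s}.
Proof.
elim: l => [|x l [s sy h]]; first by exists (y - 1); rewrite // ltrBlDr ltrDl.
have [xy|yx] := ltP x y.
  exists (Num.max x s); first by rewrite gt_max xy sy.
  move=> z; rewrite in_cons => /predU1P[-> _|zl zy]; first by rewrite le_max lexx.
  by rewrite le_max h ?orbT.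
exists s => // z; rewrite in_cons => /predU1P[->|]; last exact: h.
by rewrite ltNge yx.
Qed.

Lemma perm_link (T1 T2 T3 : eqType) (M1 : seq (T1 * T2)) (M2 : seq (T1 * T3)) :
  perm_eq (unzip1 M1) (unzip1 M2) -> exists M : seq (T2 * T3),
  [/\ perm_eq (unzip2 M1) (unzip1 M), perm_eq (unzip2 M2) (unzip2 M) &
   forall x y, (x, y) \in M -> exists2 z, (z, x) \in M1 & (z, y) \in M2].
Proof.
elim: M1 M2 => [|[z x] M1 IH] M2 /=.
  by move=> /perm_size /esym/size0nil; case: M2 => // _; exists [::].
move=> pe; have /mapP[[z' y] zM2 /= zz'] : z \in unzip1 M2.
  by rewrite -(perm_mem pe) mem_head.
rewrite -{z'}zz' in zM2; have p2 := perm_to_rem zM2.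
have /IH[M [q1 q2 h]] : perm_eq (unzip1 M1) (unzip1 (rem (z, y) M2)).
  by rewrite -(perm_cons z) (perm_trans pe) // /unzip1 (perm_map _ p2).
exists ((x, y) :: M); split=> [||x' y'].
- by rewrite /= perm_cons.
- by rewrite (perm_trans (perm_map snd p2)) //= perm_cons.
rewrite in_cons => /predU1P[[-> ->]|/h[z' h1 h2]]; first by exists z; rewrite ?mem_head.
by exists z'; rewrite ?in_cons ?h1 ?orbT // (mem_rem h2).
Qed.

Definition wf_bar p := if p.2 is Some y then p.1 < y else true.

Variables (eta : R) (DX DI DP : seq (R * option R)) (bX bI bP : R -> R -> nat).
Hypothesis eta_ge0 : 0 <= eta.
Hypotheses (wfX : {in DX, forall p, wf_bar p}) (wfI : {in DI, forall p, wf_bar p})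
  (wfP : {in DP, forall p, wf_bar p}).
Hypothesis cX : forall s t, s <= t -> count (alive s t) DX = bX s t.
Hypothesis cI : forall s t, s <= t -> count (alive s t) DI = bI s t.
Hypothesis cP : forall s t, s <= t -> count (alive s t) DP = bP s t.

(** The condition [b <= t] stays in the range where counts of bars are ranks. *)
Definition born_at (b t : R) p := [&& b <= t, p.1 == b & dies_after t p.2].
Definition born_at_long (b t : R) p := [&& b <= t, p.1 == b & dies_after (t + eta) p.2].

Lemma count_born_at D s b t : s < b -> {in unzip1 D, forall x, x < b -> x <= s} ->
  (count (alive b t) D = count (alive s t) D +
    count (fun p => (p.1 == b) && dies_after t p.2) D)%N.
Proof.
move=> sb gap; rewrite -count_predUI [X in (_ + X)%N](eq_count (a2 := pred0)).
  rewrite count_pred0 addn0; apply: eq_in_count => p pD.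
  rewrite /= /alive -andb_orl; congr andb; rewrite le_eqVlt orbC; congr orb.
  apply/idP/idP => [|ps]; first by apply: gap; apply: map_f.
  exact: le_lt_trans ps sb.
move=> p /=; rewrite /alive; case: eqP => [->|]; last by rewrite andbF.
by rewrite leNgt sb.
Qed.

(** In difference form: among bars born in (s', s], at most as many outlive t in the image as in X.
    By [ker], at least as many do as outlive t + eta in X. *)
Hypothesis epi : forall s' s t, s' <= s -> s <= t ->
  (bI s t + bX s' t <= bX s t + bI s' t)%N.
Hypothesis ker : forall s' s t, s' <= s -> s <= t ->
  (bX s (t + eta) + bI s' t <= bI s t + bX s' (t + eta))%N.

Definition death_le (u v : option R) :=
  match u, v with Some x, Some y => x <= y | _, None => true | None, Some _ => false end.

(** The image is a quotient of X: births are kept, the longest bars of equal birth are matched, and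
    the kernel condition limits the loss of life to [eta]. *)
Lemma epi_matching : exists (M : seq ((R * option R) * (R * option R))) rest,
    [/\ perm_eq DI (unzip1 M), perm_eq DX (unzip2 M ++ rest),
     forall u v, (u, v) \in M -> u.1 = v.1 /\
       match u.2, v.2 with
       | Some x, Some y => x <= y <= x + eta | None, None => true | _, _ => false end &
     forall v, v \in rest -> if v.2 is Some y then y <= v.1 + eta else false].
Proof.
have cnt b t : b <= t -> forall t', t <= t' -> exists s, [/\ s <= b,
    (count (alive b t') DX = count (alive s t') DX +
      count (fun p => (p.1 == b) && dies_after t' p.2) DX)%N,
    (count (alive b t') DI = count (alive s t') DI +
      count (fun p => (p.1 == b) && dies_after t' p.2) DI)%N,
    (count (alive b t) DX = count (alive s t) DX +
      count (fun p => (p.1 == b) && dies_after t p.2) DX)%N &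
    (count (alive b t) DI = count (alive s t) DI +
      count (fun p => (p.1 == b) && dies_after t p.2) DI)%N].
  move=> bt t' tt'; have [s sb gap] := gap_below (unzip1 DX ++ unzip1 DI) b.
  have gX : {in unzip1 DX, forall x, x < b -> x <= s}.
    by move=> x xD; apply: gap; rewrite mem_cat xD.
  have gI : {in unzip1 DI, forall x, x < b -> x <= s}.
    by move=> x xD; apply: gap; rewrite mem_cat xD orbT.
  by exists s; split; [exact: ltW|exact: count_born_at..].
have [||||j a c|||||M [rest [pI pX good bad]]] := @greedy_matching _ R (R * R) fst
  (fun p q => death_le p.2 q.2) _ _ (fun j => born_at j.1 j.2)
  (fun j => born_at_long j.1 j.2) _ _ _ _ DI DX.
- by move=> [? [x|]] [? [y|]] //=; apply: le_total.
- by move=> [? [x|]] [? [y|]] [? [z|]] //=; apply: le_trans.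
- by move=> j p q /and3P[_ /eqP -> _] /and3P[_ /eqP ->].
- move=> j [p1 p2] [q1 q2]; rewrite /born_at /= => <- pq /and3P[bt pb dp]; apply/and3P; split=> //.
  by case: p2 q2 pq dp => [x|] [y|] //= xy tx; apply: lt_le_trans xy.
- case: a c => p1 p2 [q1 q2]; rewrite /born_at_long /= => <- pq /and3P[bt pb dp].
  apply/and3P; split=> //.
  by case: p2 q2 pq dp => [x|] [y|] //= xy tx; apply: lt_le_trans xy.
- move=> j [p1 p2]; rewrite /born_at_long /born_at /= => /and3P[bt pb dp].
  apply/and3P; split=> //; by case: p2 dp => [x|] //=; apply: le_lt_trans; rewrite lerDl.
- move=> [p1 p2] pI; exists (p1, p1); rewrite /born_at /= lexx eqxx /=.
  by have := wfI pI; rewrite /wf_bar; case: p2 {pI}.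
- move=> [b t] /=; rewrite /born_at; have [bt|] := leP b t; last by rewrite !count_pred0.
  have [s [sb _ _]] := cnt b t bt t (lexx t).
  have := epi sb bt; rewrite !cX ?cI ?(le_trans sb) //=; lia.
- move=> [b t] /=; rewrite /born_at_long /born_at.
  have [bt|] := leP b t; last by rewrite !count_pred0.
  have te : t <= t + eta by rewrite lerDl.
  have [s [sb e1 _ _ e2]] := cnt b t bt (t + eta) te.
  have := ker sb bt; move: e1 e2; rewrite !cX ?cI ?(le_trans bt) ?(le_trans sb) //=; first lia.
  by rewrite (le_trans bt).
exists M, rest; split=> //.
  move=> [u1 u2] [v1 v2] uvM; have [/= e h1 h2] := good _ _ uvM; split=> //.
  have uI : (u1, u2) \in DI by rewrite (perm_mem pI) (map_f fst uvM).
  have vX : (v1, v2) \in DX by rewrite (perm_mem pX) mem_cat (map_f snd uvM).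
  have := wfI uI; have := wfX vX; rewrite /wf_bar /=.
  have {}h1 t : v1 <= t -> dies_after t u2 -> dies_after t v2.
    by move=> vt tu; have := h1 (u1, t); rewrite /born_at /= e vt eqxx tu => /(_ isT).
  have {}h2 t : v1 <= t -> dies_after (t + eta) v2 -> dies_after t u2.
    by move=> vt tu; have := h2 (u1, t); rewrite /born_at_long /born_at /= e vt eqxx tu => /(_ isT).
  case: u2 v2 {uvM uI vX} h1 h2 => [x|] [y|] //= h1 h2 vy ux.
  - apply/andP; split; rewrite leNgt; apply/negP => lt.
      by have := h1 y (ltW vy) lt; rewrite ltxx.
    by have := h2 x _ lt; rewrite ltxx -e => /(_ (ltW ux)).
  - by have := h2 x _ isT; rewrite ltxx -e => /(_ (ltW ux)).
  - by have := h1 y (ltW vy) isT; rewrite ltxx.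
move=> [v1 v2] /bad /= h; have := h (v1, v1); rewrite /born_at_long /= lexx eqxx /=.
by case: v2 {h} => [y|] //=; rewrite -leNgt.
Qed.


Definition dies_at (u : option R) (s : R) p :=
  [&& (if u is Some y then s < y else true), p.2 == u & p.1 <= s].
Definition dies_at_long (u : option R) (s : R) p :=
  [&& (if u is Some y then s < y else true), p.2 == u & p.1 + eta <= s].

Lemma count_dies_at D s t y : t < y -> {in pmap snd D, forall x, x < y -> x <= t} ->
  (count (alive s t) D = count (alive s y) D +
    count (fun p => (p.2 == Some y) && (p.1 <= s)%R) D)%N.
Proof.
move=> ty gap; rewrite -count_predUI [X in (_ + X)%N](eq_count (a2 := pred0)).
  rewrite count_pred0 addn0; apply: eq_in_count => p pD.
  rewrite /= /alive (andbC (_ == _)) -andb_orr; congr andb.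
  case: p pD => p1 [x|] //= pD; apply/idP/idP => [tx|].
    rewrite orbC; case: eqP => //= ne; rewrite ltNge le_eqVlt.
    apply/negP => /predU1P[e|xy]; first by case: ne; rewrite e.
    have : x \in pmap snd D by rewrite mem_pmap; apply/mapP; exists (p1, Some x).
    by move=> /gap /(_ xy); rewrite leNgt tx.
  by case/orP => [|/eqP [->]//]; apply: lt_trans.
move=> p /=; rewrite /alive; case: eqP => [->|]; last by rewrite andbF.
by rewrite /= ltxx andbF.
Qed.

Lemma count_dies_never D s t : {in pmap snd D, forall x, x <= t} ->
  count (alive s t) D = count (fun p => (p.2 == None) && (p.1 <= s)) D.
Proof.
move=> ub; apply: eq_in_count => -[p1 [x|]] pD; rewrite /alive /= ?andbT //.
rewrite ltNge ub ?andbF //.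
by rewrite mem_pmap; apply/mapP; exists (p1, Some x).
Qed.

Lemma upper_bound (l : seq R) s : exists2 t, s <= t & {in l, forall x, x <= t}.
Proof.
elim: l => [|x l [t st h]]; first by exists s.
exists (Num.max x t); first by rewrite le_max st orbT.
move=> z; rewrite in_cons le_max => /predU1P[->|/h ->]; by rewrite ?lexx ?orbT.
Qed.

(** In difference form, a comparison of bars born by s that die in (t', t]. The [_oo] variants treat
    bars that never die, which no difference isolates. *)
Hypothesis mono : forall s t' t, s <= t' -> t' <= t ->
  (bI s t' + bP s t <= bP s t' + bI s t)%N.
Hypothesis mono_oo : forall s t, s <= t -> (bI s t <= bP s t)%N.
Hypothesis coker : forall s t' t, s + eta <= t' -> t' <= t ->
  (bP s t' + bI (s + eta) t <= bI (s + eta) t' + bP s t)%N.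
Hypothesis coker_oo : forall s t, s + eta <= t -> (bP s t <= bI (s + eta) t)%N.

(** Dual to the quotient case: deaths are kept, the earliest births of equal death are matched, and
    the cokernel condition limits the delay of a birth to [eta]. *)
Lemma mono_matching : exists (M : seq ((R * option R) * (R * option R))) rest,
    [/\ perm_eq DI (unzip1 M), perm_eq DP (unzip2 M ++ rest),
     forall u v, (u, v) \in M -> u.2 = v.2 /\ v.1 <= u.1 <= v.1 + eta &
     forall v, v \in rest -> if v.2 is Some y then y <= v.1 + eta else false].
Proof.
(* [t] sits just below the death y, or above all finite deaths if [u] is [None]. *)
have cnt u s s' : s' <= s -> (if u is Some y then s < y else true) ->
  exists t, s <= t /\
  if u is Some y then [/\ t <= y,
    (count (alive s t) DI = count (alive s y) DI +
      count (fun p => (p.2 == u) && (p.1 <= s)%R) DI)%N &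
    (count (alive s' t) DP = count (alive s' y) DP +
      count (fun p => (p.2 == u) && (p.1 <= s')%R) DP)%N]
  else count (alive s t) DI = count (fun p => (p.2 == u) && (p.1 <= s)) DI /\
    count (alive s' t) DP = count (fun p => (p.2 == u) && (p.1 <= s')) DP.
  move=> ss; case: u => [y sy|_].
    have [t ty gap] := gap_below (s :: pmap snd DI ++ pmap snd DP) y.
    exists t; split; first by apply: gap; rewrite ?mem_head.
    split; [exact: ltW| |]; apply: count_dies_at => // x xD; apply: gap;
      by rewrite in_cons mem_cat xD ?orbT.
  have [t st ub] := upper_bound (pmap snd DI ++ pmap snd DP) s.
  exists t; split=> //; split; apply: count_dies_never => x xD; apply: ub;
    by rewrite mem_cat xD ?orbT.
have [||||j p q|||||M [rest [pI pP good bad]]] := @greedy_matching _ (option R)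
  (option R * R) snd (fun p q => q.1 <= p.1) _ _ (fun j => dies_at j.1 j.2)
  (fun j => dies_at_long j.1 j.2) _ _ _ _ DI DP.
- by move=> p q; apply: le_total.
- by move=> p q r qp rq; apply: le_trans qp.
- by move=> j p q /and3P[_ /eqP -> _] /and3P[_ /eqP ->].
- move=> j p q e qp /and3P[h1 h2 h3]; apply/and3P; split=> //; rewrite -?e //.
  exact: le_trans h3.
- move=> e qp /and3P[h1 h2 h3]; apply/and3P; split=> //; rewrite -?e //.
  by apply: le_trans h3; rewrite lerD2r.
- move=> j p /and3P[h1 h2 h3]; apply/and3P; split=> //.
  by apply: le_trans h3; rewrite lerDl.
- move=> p /wfI wp; exists (p.2, p.1); rewrite /dies_at /= eqxx lexx !andbT.
  exact: wp.
- move=> [u s]; rewrite /dies_at /=.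
  case: (boolP (if u is Some y then s < y else true)) => [us|_]; last first.
    by rewrite !count_pred0.
  have [t [st h]] := cnt u s s (lexx s) us.
  case: u us h => [y sy [ty]|_ []].
    by have := mono st ty; rewrite !cI ?cP ?(le_trans st) //=; lia.
  by have := mono_oo st; rewrite !cI ?cP //= => ? <- <-.
- move=> [u s]; rewrite /dies_at /dies_at_long /=.
  case: (boolP (if u is Some y then s < y else true)) => [us|_]; last first.
    by rewrite !count_pred0.
  (* Bars of the target born by s - eta are charged to bars of the image born by s. *)
  have es : s - eta + eta = s by rewrite subrK.
  have ses : s - eta <= s by rewrite lerBlDr lerDl.
  have [t [st h]] := cnt u s (s - eta) ses us.
  rewrite (eq_count (a2 := fun p => (p.2 == u) && (p.1 <= s - eta))); last first.
    by move=> p; rewrite /= lerBrDr.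
  case: u us h => [y sy [ty]|_ []].
    have := @coker (s - eta) t y; rewrite es => /(_ st ty).
    by rewrite !cI ?cP ?(le_trans st) ?(le_trans ses) ?(le_trans st) //=; lia.
  have := @coker_oo (s - eta) t; rewrite es => /(_ st).
  by rewrite !cI ?cP ?(le_trans ses) //= => ? <- <-.
exists M, rest; split=> //.
  move=> [u1 u2] [v1 v2] uvM; have [/= e h1 h2] := good _ _ uvM; split=> //.
  have uI : (u1, u2) \in DI by rewrite (perm_mem pI) (map_f fst uvM).
  have vP : (v1, v2) \in DP by rewrite (perm_mem pP) mem_cat (map_f snd uvM).
  have := wfI uI; have := wfP vP; rewrite /wf_bar /= => wv wu.
  have /and3P[_ _ -> /=] : dies_at u2 u1 (v1, v2).
    by apply: (h1 (u2, u1)); rewrite /dies_at /= eqxx lexx !andbT.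
  rewrite leNgt; apply/negP => lt.
  have wu' : is_true (if u2 is Some y then v1 + eta < y else true).
    by case: (u2) wu => // y; apply: lt_trans.
  have /and3P[_ _ /=] : dies_at u2 (v1 + eta) (u1, u2).
    by apply: (h2 (u2, v1 + eta)); rewrite /dies_at_long /= -e eqxx lexx !andbT.
  by rewrite leNgt lt.
move=> [v1 v2] /bad /= h; have := h (v2, v1 + eta).
rewrite /dies_at_long /= eqxx lexx !andbT.
by case: v2 {h} => [y|] //=; rewrite -leNgt.
Qed.

Lemma induced_matching : exists (M : seq ((R * option R) * (R * option R))) restX restP,
    [/\ perm_eq DX (unzip1 M ++ restX), perm_eq DP (unzip2 M ++ restP),
     forall u v, (u, v) \in M -> v.1 <= u.1 <= v.1 + eta /\
       match u.2, v.2 with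
       | Some x, Some y => y <= x <= y + eta | None, None => true | _, _ => false end,
     forall v, v \in restX -> if v.2 is Some y then y <= v.1 + eta else false &
     forall v, v \in restP -> if v.2 is Some y then y <= v.1 + eta else false].
Proof.
have [M1 [rX [pI1 pX good1 bad1]]] := epi_matching.
have [M2 [rP [pI2 pP good2 bad2]]] := mono_matching.
have [|M [pM1 pM2 link]] := @perm_link _ _ _ M1 M2.
  by rewrite -(permPl pI1).
exists M, rX, rP; split=> //.
- by rewrite (permPl pX) perm_cat2r.
- by rewrite (permPl pP) perm_cat2r.
move=> x p /link[i /good1[ix dx] /good2[id bi]]; rewrite -ix -id; split=> //.
by move: dx; case: (i.2) => [?|]; case: (x.2).
Qed.

End InducedMatching.
(** * The bottleneck distance *)

Section BottleneckBound.
Variables (R : realType) (e : R).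
Hypothesis e_ge0 : 0 <= e.
Implicit Types (p q : R * option R) (D : seq (R * option R)).

Lemma linfC p q : linf p q = linf q p.
Proof.
rewrite /linf distrC; congr maxe; case: (p.2) (q.2) => [x|] [y|] //=.
by rewrite distrC.
Qed.

Lemma aug_costC D1 D2 (a : aug D1) (b : aug D2) : aug_cost a b = aug_cost b a.
Proof. by case: a b => [i|z] [j|z'] //; rewrite /aug_cost linfC. Qed.

Definition matched_within D1 D2 := exists f : aug D1 -> aug D2,
  bijective f /\ forall a, (aug_cost a (f a) <= e%:E)%E.

Lemma matched_within_sym D1 D2 : matched_within D1 D2 -> matched_within D2 D1.
Proof.
case=> f [[g fK gK] h]; exists g; split; first by exists f.
by move=> b; rewrite aug_costC -{2}(gK b); apply: h.
Qed.

(** One more bar adjoins one element to the augmented diagram, so bijections extend by [omap]. *)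
Definition aug_cons p D (o : option (aug D)) : aug (p :: D) :=
  match o with
  | None => inl ord0
  | Some (inl i) => inl (lift ord0 i)
  | Some (inr z) => inr z
  end.

Definition aug_uncons p D (a : aug (p :: D)) : option (aug D) :=
  match a with
  | inl i => omap inl (unlift ord0 i)
  | inr z => Some (inr z)
  end.

Lemma aug_consK p D : cancel (@aug_cons p D) (@aug_uncons p D).
Proof. by case=> [[i|z]|] //=; rewrite ?liftK ?unlift_none. Qed.

Lemma aug_unconsK p D : cancel (@aug_uncons p D) (@aug_cons p D).
Proof. by case=> [i|z] //=; case: unliftP => [j ->|->]. Qed.

Lemma matched_within_cons p q D1 D2 : (linf p q <= e%:E)%E ->
  matched_within D1 D2 -> matched_within (p :: D1) (q :: D2).
Proof.
move=> pq [f [[g fK gK] h]].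
exists (@aug_cons q D2 \o omap f \o @aug_uncons p D1); split.
  exists (@aug_cons p D1 \o omap g \o @aug_uncons q D2) => a /=.
    by rewrite aug_consK (omapK fK) aug_unconsK.
  by rewrite aug_consK (omapK gK) aug_unconsK.
move=> a; rewrite -(aug_unconsK a); case: (aug_uncons a) => [b|];
  rewrite /comp aug_consK //=; apply: le_trans (h b).
by case: b => [i|[x n]] /=; case: (f _) => [j|[y k]].
Qed.

(* Makes room for one more copy of the diagonal point (x, x). *)
Definition shift_diag x D (o : option (aug D)) : aug D :=
  match o with
  | None => inr (x, 0%N)
  | Some (inl i) => inl i
  | Some (inr (y, n)) => inr (y, if y == x then n.+1 else n)
  end.

Definition unshift_diag x D (a : aug D) : option (aug D) :=
  match a with
  | inl i => Some (inl i)
  | inr (y, n) => if y == x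
      then if n is n'.+1 then Some (inr (y, n')) else None else Some (inr (y, n))
  end.

Lemma shift_diagK x D : cancel (@shift_diag x D) (@unshift_diag x D).
Proof.
case=> [[i|[y n]]|] //=; last by rewrite eqxx.
by case: eqP.
Qed.

Lemma unshift_diagK x D : cancel (@unshift_diag x D) (@shift_diag x D).
Proof.
case=> [i|[y n]] //=; have [->|yx] := eqVneq y x; last by rewrite /= (negPf yx).
by case: n => [|n] //=; rewrite eqxx.
Qed.

Definition short p := if p.2 is Some y then p.1 <= y <= p.1 + 2 * e else false.

(** The bar goes to the diagonal point at its midpoint, at distance half its length. *)
Lemma matched_within_short p D1 D2 : short p ->
  matched_within D1 D2 -> matched_within (p :: D1) D2.
Proof.
case: p => b [y|] // /andP[/= by1 yb] [f [[g fK gK] h]]; pose x := (b + y) / 2.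
exists (@shift_diag x D2 \o omap f \o @aug_uncons (b, Some y) D1); split.
  exists (@aug_cons (b, Some y) D1 \o omap g \o @unshift_diag x D2) => a /=.
    by rewrite shift_diagK (omapK fK) aug_unconsK.
  by rewrite aug_consK (omapK gK) unshift_diagK.
move=> a; rewrite -(aug_unconsK a); case: (aug_uncons a) => [c|];
  rewrite /comp aug_consK /=.
  apply: le_trans (h c).
  by case: c => [i|[x' n]] /=; case: (f _) => [j|[z k]].
rewrite /linf /= ge_max !lee_fin /x; apply/andP; split; rewrite ler_norml; lra.
Qed.

Lemma matched_within_perm D1 D1' D2 : perm_eq D1' D1 ->
  matched_within D1 D2 -> matched_within D1' D2.
Proof.
move=> /(perm_iotaP (0, None))[Is pIs D1E] [f [[g fK gK] h]].
have sz : size D1' = size D1 by rewrite D1E size_map (perm_size pIs) size_iota.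
have lt (i : 'I_(size D1')) : (nth 0 Is i < size D1)%N.
  have : nth 0%N Is i \in Is by rewrite mem_nth // (perm_size pIs) size_iota -sz.
  by rewrite (perm_mem pIs) mem_iota.
pose r (i : 'I_(size D1')) := Ordinal (lt i).
have r_inj : injective r.
  move=> i j /(congr1 val) /= /eqP; rewrite nth_uniq ?(perm_size pIs) ?size_iota -?sz //.
    by move=> /eqP /val_inj.
  by rewrite (perm_uniq pIs) iota_uniq.
have [r' rK r'K] : bijective r by apply: inj_card_bij r_inj _; rewrite !card_ord sz.
have nE j : (j < size D1')%N -> nth (0, None) D1' j = nth (0, None) D1 (nth 0%N Is j).
  by move=> jD; rewrite D1E (nth_map 0%N) // (perm_size pIs) size_iota -sz.
pose s (a : aug D1') : aug D1 := match a with inl i => inl (r i) | inr z => inr z end.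
pose s' (a : aug D1) : aug D1' := match a with inl i => inl (r' i) | inr z => inr z end.
exists (f \o s); split.
  exists (s' \o g); first by move=> [i|z] /=; rewrite fK /= ?rK.
  by move=> b /=; rewrite -{2}(gK b); case: (g b) => [i|z] /=; rewrite ?r'K.
move=> a; apply: le_trans (h (s a)).
case: a => [i|z] /=; last by case: (f _) => [j|[y k]].
by rewrite nE //; case: (f _) => [j|[y k]].
Qed.

Lemma bottleneck_le (M : seq ((R * option R) * (R * option R))) r1 r2 D1 D2 :
  perm_eq D1 (unzip1 M ++ r1) -> perm_eq D2 (unzip2 M ++ r2) ->
  (forall p q, (p, q) \in M -> (linf p q <= e%:E)%E) ->
  {in r1, forall p, short p} -> {in r2, forall p, short p} ->
  (bottleneck D1 D2 <= e%:E)%E.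
Proof.
move=> p1 p2 hM h1 h2.
have [f [fb fe]] : matched_within D1 D2.
  apply: matched_within_perm p1 _; apply: matched_within_sym.
  apply: matched_within_perm p2 _; apply: matched_within_sym.
  elim: M hM => [|[p q] M IH] hM /=; last first.
    apply: matched_within_cons; first by apply: hM; rewrite mem_head.
    by apply: IH => p' q' pq; apply: hM; rewrite in_cons pq orbT.
  elim: r1 h1 => [|p r1 IH] h1 /=; last first.
    apply: matched_within_short; first by apply: h1; rewrite mem_head.
    by apply: IH => q qr; apply: h1; rewrite in_cons qr orbT.
  apply: matched_within_sym; elim: r2 h2 => [|p r2 IH] h2 /=; last first.
    apply: matched_within_short; first by apply: h2; rewrite mem_head.
    by apply: IH => q qr; apply: h2; rewrite in_cons qr orbT.
  exists id; split; first by exists id.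
  by move=> [[]|[x n]] //=; rewrite lee_fin.
apply: (@le_trans _ _ (ereal_sup (range (fun a => aug_cost a (f a))))).
  by apply: ereal_inf_lbound; exists f.
by apply: ub_ereal_sup => _ [a _ <-].
Qed.

End BottleneckBound.
(** * Interleaving of Delaunay-Rips filtrations *)

Section MappingCylinder.
Variables (F : fieldType) (m N : nat) (e : 'I_m -> 'I_N) (phi : 'I_N -> 'I_m).
Hypothesis e_mono : {mono e : i j / (i < j)%N}.
Hypothesis phiK : cancel e phi.
Variables K D : {set 'I_m} -> Prop.
Hypotheses (K0 : ~ K set0) (D0 : ~ D set0).
Hypotheses (Kc : face_closed K) (Dc : face_closed D).

(** The mapping cylinder in its largest form: testing only the image under [phi] admits simplices
    that mix both clouds, so each cloud enters by inclusion. *)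
Definition cylinder (s : {set 'I_N}) := K (phi @: s) \/ push e D s.

Lemma push0 : ~ push e D set0.
Proof. by case=> t Dt /esym/eqP; rewrite imset_eq0 => /eqP t0; apply: D0; rewrite -t0. Qed.

Lemma cylinder0 : ~ cylinder set0.
Proof. by case; [rewrite imset0|apply: push0]. Qed.

Lemma cylinder_closed : face_closed cylinder.
Proof.
move=> s t [Ks|Ds] ts t0; [left|right].
  by apply: Kc Ks (imsetS _ ts) _; rewrite imset_eq0.
exact: (face_closed_push e_mono Dc) Ds ts t0.
Qed.

Let off (s : {set 'I_N}) := [set v in s | v \notin codom e].

(* A simplex with a vertex v outside the target deformation retracts by
   toggling e (phi v), which does not change its image under phi. *)
Lemma cylinder_toggleable :
  toggleable (fun s => cylinder s /\ ~ push e (fun t => K t \/ D t) s).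
Proof.
case=> s0 Ss0; pose S s := cylinder s /\ ~ push e (fun t => K t \/ D t) s.
have S_off s : S s <-> K (phi @: s) /\ off s != set0.
  split=> [[[Ks|[t Dt st]] ns]|[Ks /set0Pn[v]]].
  - split=> //; apply/eqP => o0; apply: ns; exists (phi @: s); first by left.
    have es v : v \in s -> e (phi v) = v.
      move=> vs; have : v \notin off s by rewrite o0 inE.
      by rewrite inE vs negbK => /codomP[y ->]; rewrite phiK.
    apply/setP => v; apply/idP/imsetP => [vs|[y /imsetP[w ws ->] ->]].
      by exists (phi v); rewrite ?imset_f ?es.
    by rewrite es.
  - by case: ns; exists t => //; right.
  rewrite inE => /andP[vs ve]; split; first by left.
  case=> t _ st; case/negP: ve; move: vs; rewrite st => /imsetP[y _ ->].
  exact: codom_f.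
have [_ /set0Pn[v0 _]] := (S_off _).1 Ss0.
(* The apex depends on [off s] only, and the level is its size; an inclusion within one level
   therefore keeps the apex. *)
pose x s := e (phi (odflt v0 [pick v in off s])).
have xP s : S s -> exists2 v, v \in off s & x s = e (phi v).
  move=> /S_off[_ /set0Pn[v vo]]; rewrite /x; case: pickP => [w wo|]; first by exists w.
  by move/(_ v); rewrite vo.
have off_e y s : off (e y |: s) = off s /\ off (s :\ e y) = off s.
  split; apply/setP => v; rewrite !inE; have [->|//] := eqVneq v (e y);
    by rewrite codom_f !andbF.
exists (fun s => #|off s|), x; split=> [s Ss|s t Ss St st].
  have [v] := xP _ Ss; rewrite inE => /andP[vs ve] ->.
  have [Ks o0] := (S_off _).1 Ss; have [o1 o2] := off_e (phi v) s.
  have [i1 i2] : phi @: (e (phi v) |: s) = phi @: s /\ phi @: (s :\ e (phi v)) = phi @: s.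
    split; last first.
      apply/eqP; rewrite eqEsubset imsetS ?subD1set //; apply/subsetP => y.
      case/imsetP => w ws ->; have [we|we] := eqVneq w (e (phi v)).
        rewrite we phiK imset_f // !inE vs andbT.
        by apply: contraNneq ve => ->; apply: codom_f.
      by rewrite imset_f // !inE we.
    by rewrite imsetU1 phiK; apply/setUidPr; rewrite sub1set imset_f.
  split; first by apply/S_off; rewrite i1 o1.
  - by apply/S_off; rewrite i2 o2.
  - by rewrite o1.
  - by rewrite o2.
have os : off s \subset off t.
  by apply/subsetP => v; rewrite !inE => /andP[/(subsetP st) -> ->].
split; first exact: subset_leq_card.
by move=> /eqP; rewrite (subset_leqif_cards os) => /eqP oe; rewrite /x oe.
Qed.

Lemma cylinder_relacyclic k : relacyclic F (fun t => K t \/ D t) D k ->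
  relacyclic F cylinder (push e D) k.
Proof.
move=> KD; apply: (relacyclic_trans (L := push e (fun t => K t \/ D t))).
- move=> _ [t [Kt|Dt] ->]; last by right; exists t.
  left; rewrite -imset_comp (eq_imset (g := id)) ?imset_id //; exact: phiK.
- by move=> _ [t Dt ->]; exists t => //; right.
- apply: toggleable_relacyclic.
  + exact: cylinder0.
  + exact: cylinder_closed.
  + apply: face_closed_push => // s t [Ks|Ds] ts t0; [left|right].
      exact: Kc Ks ts t0.
    exact: Dc Ds ts t0.
  + move=> _ [t [Kt|Dt] ->]; last by right; exists t.
    left; rewrite -imset_comp (eq_imset (g := id)) ?imset_id //; exact: phiK.
  + exact: cylinder_toggleable.
- exact: relacyclic_push.
Qed.

End MappingCylinder.

(** * Cech complexes relative to Delaunay-Rips complexes *)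

Section Complexes.
Variables (R : realType) (F : fieldType) (d m : nat) (Y : 'I_m -> 'rV[R]_d).
Implicit Types (t : {set 'I_m}) (a r s : R).

Lemma diam_of_ge0 t : 0 <= diam_of Y t.
Proof. exact: bigmax_ge_id. Qed.

Lemma diam_ofP t a : 0 <= a -> diam_of Y t <= a <->
  forall i j, i \in t -> j \in t -> edist (Y i) (Y j) <= a.
Proof.
move=> a0; split=> [h i j it jt|h].
  apply: le_trans h; apply: (bigmax_sup i) => //; exact: (bigmax_sup j).
apply: bigmax_le => // i it; apply: bigmax_le => // j jt; exact: h.
Qed.

Lemma edist_le_diam t i j : i \in t -> j \in t ->
  edist (Y i) (Y j) <= diam_of Y t.
Proof. exact: (diam_ofP t (diam_of_ge0 t)).1 (lexx _) i j. Qed.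

Lemma diam_ofS t t' : t \subset t' -> diam_of Y t <= diam_of Y t'.
Proof.
move=> /subsetP tt; apply/(diam_ofP _ (diam_of_ge0 t')) => i j /tt it /tt jt.
exact: edist_le_diam.
Qed.

Lemma DR_closed r : face_closed (DR Y r).
Proof.
move=> t t' [/delaunay_center[_ [y yt]] dt] /[dup] tt /subsetP tt' t0; split.
  by apply/delaunay_center; split=> //; exists y => q j /tt'; apply: yt.
exact: le_trans (diam_ofS tt) dt.
Qed.

Lemma DR0 r : ~ DR Y r set0.
Proof. by case=> -[/eqP]. Qed.

Lemma DR_mono r r' t : r <= r' -> DR Y r t -> DR Y r' t.
Proof. by move=> rr [h1 h2]; split=> //; apply: le_trans h2 _; lra. Qed.

(** The sign condition makes the complex empty at negative radii, which the square would not
    notice. *)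
Definition cech s t := [/\ t != set0, 0 <= s & in_cech Y (s ^+ 2) t].

Lemma cech_closed s : face_closed (cech s).
Proof.
move=> t t' [_ s0 [z zt]] /subsetP tt t0; split=> //.
by exists z => q /tt; apply: zt.
Qed.

Lemma cech0 s : ~ cech s set0.
Proof. by case=> /eqP. Qed.

Lemma cech_mono s s' t : s <= s' -> cech s t -> cech s' t.
Proof.
move=> ss [t0 s0 [z zt]]; split=> //; first exact: le_trans ss.
exists z => q /zt /le_trans; apply; rewrite ler_sqr ?nnegrE //.
exact: le_trans ss.
Qed.

Lemma cech_diam s t : cech s t -> diam_of Y t <= 2 * s.
Proof.
move=> [_ s0 [z zt]]; have s20 : 0 <= 2 * s by lra.
apply/diam_ofP => // i j it jt; rewrite edist_sqn //.
have := zt _ it; have := zt _ jt.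
have -> : Y i - Y j = (z - Y j) - (z - Y i) by rewrite opprB [RHS]addrC addrA subrK.
have := sqn_sub_le (z - Y j) (z - Y i); lra.
Qed.

(** The diameter bound puts every Delaunay simplex of the Cech complex into the Delaunay-Rips
    complex, so exactly the non-Delaunay ones remain to be cancelled. *)
Lemma cech_DR_relacyclic s r k :
  (forall t, cech s t -> diam_of Y t <= 2 * r) ->
  relacyclic F (fun t => cech s t \/ DR Y r t) (DR Y r) k.
Proof.
move=> sr; apply: toggleable_relacyclic.
- by case; [apply: cech0|apply: DR0].
- move=> t t' [h|h] tt t0; [left|right]; [exact: cech_closed h tt t0|exact: DR_closed h tt t0].
- exact: DR_closed.
- by right.
have [s0|s0] := leP 0 s; last first.
  by move=> [t [[[_ h _]|Dt] nD]]; [move: h; rewrite leNgt s0|case: nD].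
have -> : (fun t => (cech s t \/ DR Y r t) /\ ~ DR Y r t) =
    (fun Q => (Q != set0 /\ in_cech Y (s ^+ 2) Q) /\ ~ delaunay Y Q).
  apply/funext => t; apply/propext; split=> [[[ct|//] nD]|[[t0 ct] nD]].
    by case: (ct) => t0 _ ict; split=> // dt; apply: nD; split=> //; apply: sr.
  by split; [left|case].
exact: cech_delaunay_toggleable.
Qed.

End Complexes.
Section Diagram.
Variables (R : realType) (F : fieldType) (d n : nat) (X : 'I_n -> 'rV[R]_d).

Lemma mem_crit s : delaunay X s -> diam_of X s / 2 \in crit X.
Proof.
move=> Ds; rewrite mem_sort mem_undup; apply/mapP; exists s => //.
by rewrite mem_enum inE; apply/asboolP.
Qed.

Lemma crit_sorted : sorted <%R (crit X).
Proof. by rewrite sort_lt_sorted undup_uniq. Qed.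

Lemma DR_const s s' : {in crit X, forall x, (x <= s) = (x <= s')} ->
  DR X s = DR X s'.
Proof.
move=> h; apply/funext => t; apply/propext.
have e : delaunay X t -> (diam_of X t <= 2 * s) = (diam_of X t <= 2 * s').
  by move=> Dt; rewrite ![2 * _]mulrC -!ler_pdivrMr // h // mem_crit.
by split=> -[Dt h']; split=> //; [rewrite -e|rewrite e].
Qed.

Lemma DR_below s t : {in crit X, forall x, s < x} -> ~ DR X s t.
Proof.
move=> h [/mem_crit /h lt]; rewrite mulrC -ler_pdivrMr // => le.
by have := lt_le_trans lt le; rewrite ltxx.
Qed.

Lemma dgmE k : dgm X F k = dgm_of (crit X) (pbetti X F k).
Proof. by []. Qed.

Let Zk k s := cycles F (DR X s) k.
Let Bk k s := boundaries F (DR X s) k.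
Let Zk_mono k s t : s <= t -> (Zk k s <= Zk k t)%MS.
Proof. by move=> st; apply: cyclesS => u _; apply: DR_mono. Qed.
Let Bk_mono k s t : s <= t -> (Bk k s <= Bk k t)%MS.
Proof. by move=> st; apply: boundariesS => u _; apply: DR_mono. Qed.

Lemma cycles_empty N (K : {set 'I_N} -> Prop) k m (B : 'M[F]_(m, NS N)) :
  (forall s, ~ K s) -> relrank (cycles F K k) B = 0%N.
Proof.
move=> K0; rewrite /relrank (_ : \rank (cycles F K k) = 0%N) //.
apply/eqP; rewrite mxrank_eq0; apply/eqP/row_matrixP => i; rewrite row0.
have /cyclesP[/chainsP h _] := row_sub i (cycles F K k).
apply: coef_eq => s; rewrite coef0; apply/eqP; apply: contrapT => /negP /h[Ks _].
exact: K0 Ks.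
Qed.

Lemma count_dgm k s t : s <= t -> count (alive s t) (dgm X F k) = pbetti X F k s t.
Proof.
rewrite dgmE; apply: count_alive; first exact: crit_sorted.
- by move=> {}s {}t _ h; apply: cycles_empty => u; apply: DR_below.
- by move=> {}s s' {}t t' _ _ hs ht; rewrite /pbetti (DR_const hs) (DR_const ht).
- by move=> s' {}s {}t ss st; apply: relrank_leq; [apply: Zk_mono|].
- by move=> {}s {}t t' st tt; apply: relrank_leq; [|apply: Bk_mono].
- by move=> s' {}s {}t t' ss st tt; apply: relrank_Frobenius; [apply: Zk_mono|apply: Bk_mono].
Qed.

Lemma dgm_wf k : {in dgm X F k, forall p, wf_bar p}.
Proof.
move=> p; rewrite dgmE => /(mem_dgm_of crit_sorted)[_].
by rewrite /wf_bar; case: (p.2) => // y [].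
Qed.

End Diagram.
Section DelaunayRipsCylinder.
Variables (R : realType) (F : fieldType) (d n m N k : nat).
Variables (X : 'I_n -> 'rV[R]_d) (Y : 'I_m -> 'rV[R]_d).
Variables (e : 'I_m -> 'I_N) (psi : 'I_N -> 'I_n) (phi : 'I_N -> 'I_m).
Hypothesis e_mono : {mono e : i j / (i < j)%N}.
Hypothesis phiK : cancel e phi.
Variables (h eps : R).
Hypothesis h_ge0 : 0 <= h.
Hypothesis dist_h : forall v w, edist (Y (phi v)) (Y (phi w)) <=
  edist (X (psi v)) (X (psi w)) + 2 * h.
Local Notation c := (cDR R k.+1).
Hypothesis c_ge1 : 1 <= c.
Hypothesis eps_ge : (c - 1) * (diam Y / 2) + h <= eps.

Definition level (t : R) := c * Num.min (t + h) (diam Y / 2).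

(* Rips simplices of X of dimension at most k + 1 enter this complex at the same
   scale t (Jung), and it deformation retracts onto the Delaunay-Rips complex of
   Y at scale t + eps. *)
Definition dr_cylinder (t : R) :=
  cylinder e phi (cech Y (level t)) (DR Y (t + eps)).

(** Write c mu = mu + (c - 1) mu: the first part is at most t + h and the second is held by the cap
    at half the diameter, so the factor c costs only a summand. *)
Lemma level_le t : 0 <= level t -> level t <= t + eps.
Proof.
rewrite /level; set mu := Num.min _ _ => l0.
have mu0 : 0 <= mu by rewrite -(pmulr_rge0 _ (lt_le_trans ltr01 c_ge1)).
have m1 : mu <= t + h by rewrite ge_min lexx.
have m2 : mu <= diam Y / 2 by rewrite ge_min lexx orbT.
have : (c - 1) * mu <= (c - 1) * (diam Y / 2) by rewrite ler_wpM2l // subr_ge0.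
by have := eps_ge; lra.
Qed.

Lemma cech_level_diam t (s : {set 'I_m}) : cech Y (level t) s ->
  diam_of Y s <= 2 * (t + eps).
Proof.
move=> cs; apply: le_trans (cech_diam cs) _; rewrite ler_pM2l //.
by case: cs => _ l0 _; apply: level_le.
Qed.

Lemma level_mono t t' : t <= t' -> level t <= level t'.
Proof.
move=> tt; rewrite /level ler_pM2l ?(lt_le_trans ltr01 c_ge1) //.
by rewrite le_min !ge_min lexx orbT andbT lerD2r tt.
Qed.

Lemma dr_cylinder_mono t t' s : t <= t' -> dr_cylinder t s -> dr_cylinder t' s.
Proof.
move=> tt [cs|[u Du ->]]; [left|right].
  exact: cech_mono (level_mono tt) cs.
by exists u => //; apply: DR_mono Du; rewrite lerD2r.
Qed.

Lemma dr_cylinder_relacyclic t j :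
  relacyclic F (dr_cylinder t) (push e (DR Y (t + eps))) j.
Proof.
apply: cylinder_relacyclic => //.
- exact: cech0.
- exact: DR0.
- exact: cech_closed.
- exact: DR_closed.
- by apply: cech_DR_relacyclic; apply: cech_level_diam.
Qed.

Lemma dr_cylinder_diam t s v w : dr_cylinder t s -> v \in s -> w \in s ->
  edist (Y (phi v)) (Y (phi w)) <= 2 * (t + eps).
Proof.
case=> [/cech_level_diam ds|[u [_ du] ->]].
  move=> vs ws; apply: le_trans ds.
  by apply: edist_le_diam; apply: imset_f.
move=> /imsetP[y yu ->] /imsetP[y' yu' ->]; rewrite !phiK; apply: le_trans du.
exact: edist_le_diam.
Qed.

Lemma dr_cylinder_intro (t : R) (s : {set 'I_N}) : s != set0 -> (#|s| <= k.+2)%N ->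
  (forall v w, v \in s -> w \in s -> edist (X (psi v)) (X (psi w)) <= 2 * t) ->
  dr_cylinder t s.
Proof.
move=> /set0Pn[v0 v0s] cs ds; left.
have t0 : 0 <= 2 * t := le_trans (edist_ge0 _ _) (ds _ _ v0s v0s).
have d0 : 0 <= diam Y := diam_of_ge0 _ _.
have mu0 : 0 <= Num.min (t + h) (diam Y / 2).
  by rewrite le_min; apply/andP; split; have := h_ge0; lra.
have Q0 : phi @: s != set0 by apply/set0Pn; exists (phi v0); rewrite imset_f.
split=> //; first by rewrite mulr_ge0 // (le_trans ler01).
apply: jung => //; first exact: leq_trans (leq_imset_card _ _) cs.
move=> _ _ /imsetP[v vs ->] /imsetP[w ws ->].
have sq4 (a : R) : 4 * a ^+ 2 = (2 * a) ^+ 2 by ring.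
rewrite sq4 -edist_sqn ?mulr_ge0 //.
have h1 : edist (Y (phi v)) (Y (phi w)) <= diam Y.
  by apply: edist_le_diam; rewrite inE.
have h2 := dist_h v w; have h3 := ds _ _ vs ws.
by rewrite mulrC -ler_pdivrMr // le_min; apply/andP; split; lra.
Qed.

End DelaunayRipsCylinder.

(** * Comparison of the two filtrations on the disjoint union *)

Section Interleaving.
Variables (R : realType) (F : fieldType) (d n m N k : nat).
Variables (X : 'I_n -> 'rV[R]_d) (Y : 'I_m -> 'rV[R]_d).
Variables (eX : 'I_n -> 'I_N) (eY : 'I_m -> 'I_N).
Variables (psi : 'I_N -> 'I_n) (phi : 'I_N -> 'I_m).
Hypotheses (eX_mono : {mono eX : i j / (i < j)%N})
  (eY_mono : {mono eY : i j / (i < j)%N}).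
Hypotheses (psiK : cancel eX psi) (phiK : cancel eY phi).
Variables (h eps : R).
Hypothesis h_ge0 : 0 <= h.
Hypothesis dist_h : forall v w,
  `|edist (X (psi v)) (X (psi w)) - edist (Y (phi v)) (Y (phi w))| <= 2 * h.
Local Notation c := (cDR R k.+1).
Hypothesis c_ge1 : 1 <= c.
Hypothesis eps_geX : (c - 1) * (diam X / 2) + h <= eps.
Hypothesis eps_geY : (c - 1) * (diam Y / 2) + h <= eps.

Let eps_ge0 : 0 <= eps.
Proof.
apply: le_trans eps_geX; rewrite addr_ge0 // mulr_ge0 ?subr_ge0 //.
by rewrite divr_ge0 // diam_of_ge0.
Qed.

Let distXY v w : edist (Y (phi v)) (Y (phi w)) <=
  edist (X (psi v)) (X (psi w)) + 2 * h.
Proof. by have := dist_h v w; rewrite ler_norml; lra. Qed.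

Let distYX v w : edist (X (psi v)) (X (psi w)) <=
  edist (Y (phi v)) (Y (phi w)) + 2 * h.
Proof. by have := dist_h v w; rewrite ler_norml; lra. Qed.

Let PY := dr_cylinder k Y eY phi h eps.
Let PX := dr_cylinder k X eX psi h eps.
Let DX t := push eX (DR X t).
Let DY t := push eY (DR Y t).

Let retractX t j : relacyclic F (PX t) (DX (t + eps)) j.
Proof. exact: dr_cylinder_relacyclic. Qed.

Let retractY t j : relacyclic F (PY t) (DY (t + eps)) j.
Proof. exact: dr_cylinder_relacyclic. Qed.

Let PYX t (s : {set 'I_N}) : (#|s| <= k.+2)%N -> PY t s -> PX (t + eps) s.
Proof.
move=> cs Ps; apply: (dr_cylinder_intro eX eps h_ge0 distYX c_ge1 _ cs).
  by apply/eqP => s0; rewrite s0 in Ps; case: (cylinder0 (@cech0 _ _ _ Y _) (@DR0 _ _ _ Y _) Ps).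
by move=> v w vs ws; apply: (dr_cylinder_diam phiK c_ge1 eps_geY Ps).
Qed.

Let PXY t (s : {set 'I_N}) : (#|s| <= k.+2)%N -> PX t s -> PY (t + eps) s.
Proof.
move=> cs Ps; apply: (dr_cylinder_intro eY eps h_ge0 distXY c_ge1 _ cs).
  by apply/eqP => s0; rewrite s0 in Ps; case: (cylinder0 (@cech0 _ _ _ X _) (@DR0 _ _ _ X _) Ps).
by move=> v w vs ws; apply: (dr_cylinder_diam psiK c_ge1 eps_geX Ps).
Qed.

Let DXP t (s : {set 'I_N}) : (#|s| <= k.+2)%N -> DX t s -> PY t s.
Proof.
move=> cs [u [Du du] su]; apply: (dr_cylinder_intro eY eps h_ge0 distXY c_ge1 _ cs).
  by rewrite su imset_eq0; case: Du.
move=> v w; rewrite su => /imsetP[x xu ->] /imsetP[x' xu' ->]; rewrite !psiK.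
by apply: le_trans du; apply: edist_le_diam.
Qed.

Let DXm t t' s : t <= t' -> DX t s -> DX t' s.
Proof. by move=> tt [u Du ->]; exists u => //; apply: DR_mono Du. Qed.

Let DYm t t' s : t <= t' -> DY t s -> DY t' s.
Proof. by move=> tt [u Du ->]; exists u => //; apply: DR_mono Du. Qed.

Definition ZX t := cycles F (push eX (DR X t)) k.
Definition BX t := boundaries F (push eX (DR X t)) k.
Definition ZP t := cycles F (dr_cylinder k Y eY phi h eps t) k.
Definition BP t := boundaries F (dr_cylinder k Y eY phi h eps t) k.

Lemma ZX_mono s t : s <= t -> (ZX s <= ZX t)%MS.
Proof. by move=> st; apply: cyclesS => u _; apply: DXm. Qed.

Lemma BP_mono s t : s <= t -> (BP s <= BP t)%MS.
Proof. by move=> st; apply: boundariesS => u _; apply: dr_cylinder_mono. Qed.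

Lemma ZX_ZP t : (ZX t <= ZP t)%MS.
Proof. by apply: cyclesS => s cs; apply: DXP; rewrite cs. Qed.

Lemma BX_BP t : (BX t <= BP t)%MS.
Proof. by apply: boundariesS => s cs; apply: DXP; rewrite cs. Qed.

(** A filling in the cylinder over [Y] enters the cylinder over [X] at t + eps, and the retraction,
    in degree k + 1, moves it into [X] at t + 2 eps. *)
Lemma kernel_trivial s t : s <= t -> (ZX s :&: BP t <= BX (t + 2 * eps))%MS.
Proof.
move=> st; apply/rV_subP => z; rewrite sub_capmx => /andP[].
move=> /cyclesP[/chainsP zX _] /boundariesP[w wP zw].
have tt : s <= t + eps + eps by have := eps_ge0; lra.
have [||u _] := @retractX (t + eps) k.+1 w.
- by apply: (submx_trans wP); apply: chainsS => u cu; apply: PYX; rewrite cu.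
- by move=> u; rewrite -zw => /zX[Xu _]; apply: DXm tt Xu.
rewrite -/(DX _) -addrA => wX.
apply/boundariesP; exists (w - u *m bdry N F).
  by have -> : 2 * eps = eps + eps by ring.
by rewrite mulmxBl bdry_bdry subr0.
Qed.

(** The same route in degree k; the correcting chain lives in the cylinder over [X] at s + eps and
    returns to the one over [Y] eps later. *)
Lemma cokernel_trivial s : (ZP s <= ZX (s + 2 * eps) + BP (s + 2 * eps))%MS.
Proof.
apply/rV_subP => w /cyclesP[wP w0].
have e2 : s + 2 * eps = s + eps + eps by ring.
have [||u uP wX] := @retractX (s + eps) k w.
- by apply: (submx_trans wP); apply: chainsS => u cu; apply: PYX; rewrite cu.
- by move=> u; rewrite w0 coef0 eqxx.
rewrite -(subrK (u *m bdry N F) w) addmx_sub_adds //.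
  apply/cyclesP; rewrite e2; split; first exact: wX.
  by rewrite mulmxBl bdry_bdry w0 subr0.
apply/boundariesP; exists u => //; rewrite e2.
by apply: (submx_trans uP); apply: chainsS => v cv; apply: PXY; rewrite cv.
Qed.

Let ZY t := cycles F (push eY (DR Y t)) k.
Let BY t := boundaries F (push eY (DR Y t)) k.

Let DYP t s : DY (t + eps) s -> PY t s.
Proof. by right. Qed.

Let ZP_split s : (ZP s <= ZY (s + eps) + BP s)%MS.
Proof.
apply/rV_subP => w /cyclesP[wP w0].
have [||u uP wX] := @retractY s k w.
- exact: wP.
- by move=> u; rewrite w0 coef0 eqxx.
rewrite -(subrK (u *m bdry N F) w) addmx_sub_adds //.
  apply/cyclesP; split; first exact: wX.
  by rewrite mulmxBl bdry_bdry w0 subr0.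
by apply/boundariesP; exists u.
Qed.

Let ZY_cap s t : s <= t -> (ZY (s + eps) :&: BP t <= BY (t + eps))%MS.
Proof.
move=> st; apply/rV_subP => z; rewrite sub_capmx => /andP[].
move=> /cyclesP[/chainsP zY _] /boundariesP[w wP zw].
have tt : s + eps <= t + eps by rewrite lerD2r.
have [||u _ wY] := @retractY t k.+1 w.
- exact: wP.
- by move=> u; rewrite -zw => /zY[Yu _]; apply: DYm tt Yu.
apply/boundariesP; exists (w - u *m bdry N F); first exact: wY.
by rewrite mulmxBl bdry_bdry subr0.
Qed.

(** The cylinder retracts onto [Y] at scale + eps, so its ranks are those of [Y] shifted by eps. *)
Lemma relrank_P s t : s <= t ->
  relrank (ZP s) (BP t) = pbetti Y F k (s + eps) (t + eps).
Proof.
move=> st; transitivity (relrank (ZY (s + eps)) (BY (t + eps))); last first.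
  exact: relrank_push.
rewrite (@relrank_eq _ _ (ZP s) (ZY (s + eps))); first last.
- by apply: submx_trans (addsmxSl _ _); apply: cyclesS => u _; apply: DYP.
- by apply: submx_trans (ZP_split s) _; rewrite addsmxS // BP_mono.
rewrite /relrank; congr (_ - _)%N; apply/eqP; rewrite eqn_leq !mxrankS //.
  rewrite capmxS //; apply: boundariesS => u _; exact: DYP.
by rewrite sub_capmx capmxSl ZY_cap.
Qed.

Lemma relrank_X s t : relrank (ZX s) (BX t) = pbetti X F k s t.
Proof. exact: relrank_push. Qed.

(* The image module only changes where X or the shifted Y does, although the
   cylinders themselves change at other scales. *)
Lemma relrank_image_const s t t' : s <= t -> t <= t' ->
  (forall u, DR Y (t' + eps) u -> DR Y (t + eps) u) ->
  relrank (ZX s) (BP t) = relrank (ZX s) (BP t').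
Proof.
move=> st tt DD; rewrite /relrank; congr (_ - _)%N; apply/eqP.
rewrite eqn_leq !mxrankS //; first last.
  by rewrite capmxS // BP_mono.
apply/rV_subP => z; rewrite !(sub_capmx z (ZX s)) => /andP[zX zB]; rewrite zX /=.
have : (z <= ZY (t + eps) + BP t)%MS.
  apply: (submx_trans zX); apply: (submx_trans (ZX_mono st)).
  exact: (submx_trans (ZX_ZP t) (ZP_split t)).
move=> /sub_addsmxP[[u v] zE]; set y := u *m _ in zE; set b := v *m _ in zE.
have bB : (b <= BP t)%MS by apply: submxMl.
have yB' : (y <= BP t')%MS.
  have -> : y = z - b by rewrite zE addrK.
  by apply: addmx_sub => //; rewrite eqmx_opp (submx_trans bB) // BP_mono.
have : (y <= BY (t' + eps))%MS.
  by apply: submx_trans (ZY_cap tt); rewrite sub_capmx submxMl.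
move=> yY; rewrite zE addmx_sub //; apply: submx_trans yY _.
apply: boundariesS => s' _ [s'' Ds ->]; right; exists s'' => //; exact: DD.
Qed.

Lemma interleaved_bottleneck : (bottleneck (dgm X F k) (dgm Y F k) <= eps%:E)%E.
Proof.
pose bX s t := relrank (ZX s) (BX t).
pose bI s t := relrank (ZX s) (BP t).
pose bP s t := relrank (ZP s) (BP t).
pose eta := 2 * eps.
(* Diagram of the cylinder over [Y]. Undoing the shift turns displacements between 0 and [eta] into
   ones between -eps and eps. *)
pose shift (p : R * option R) := (p.1 - eps, omap (fun y => y - eps) p.2).
pose unshift (p : R * option R) := (p.1 + eps, omap (fun y => y + eps) p.2).
have shiftK : cancel shift unshift.
  by move=> [x [y|]]; rewrite /shift /unshift /= !subrK.
(* The image module may change at critical values of [X] or at shifted ones of [Y], so both form its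
   grid. *)
pose gI := sort <=%R (undup (crit X ++ [seq x - eps | x <- crit Y])).
have gI_sorted : sorted <%R gI by rewrite sort_lt_sorted undup_uniq.
have gIX s s' : {in gI, forall x, (x <= s) = (x <= s')} -> DR X s = DR X s'.
  by move=> hs; apply: DR_const => x xX; apply: hs; rewrite mem_sort mem_undup mem_cat xX.
have gIY s s' : {in gI, forall x, (x <= s) = (x <= s')} ->
    DR Y (s + eps) = DR Y (s' + eps).
  move=> hs; apply: DR_const => x xY; rewrite -!lerBlDr; apply: hs.
  by rewrite mem_sort mem_undup mem_cat; apply/orP; right; apply: map_f.
pose DI := dgm_of gI bI.
have Frob s' s t t' : s' <= s -> s <= t -> t <= t' ->
    (bI s t' + bI s' t <= bI s t + bI s' t')%N.
  by move=> ss st tt; apply: relrank_Frobenius; [apply: ZX_mono|apply: BP_mono].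
have cI s t : s <= t -> count (alive s t) DI = bI s t.
  apply: count_alive => //.
  - move=> {}s {}t _ hs; apply: cycles_empty => u [u' Du _].
    by case: (DR_below _ Du) => x xX; apply: hs; rewrite mem_sort mem_undup mem_cat xX.
  - move=> {}s s' {}t t' st st' hs ht.
    have eZ : ZX s = ZX s' by rewrite /ZX (gIX _ _ hs).
    have eDY := gIY _ _ ht; rewrite /bI eZ.
    have [tt|/ltW tt] := leP t t'.
      rewrite -eZ; apply: relrank_image_const => // u; by rewrite eDY.
    by symmetry; apply: relrank_image_const => // u; rewrite eDY.
  - by move=> s' {}s {}t ss st; apply: relrank_leq; [apply: ZX_mono|].
  - by move=> {}s {}t t' st tt; apply: relrank_leq; [|apply: BP_mono].
have wfI : {in DI, forall p, wf_bar p}.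
  by move=> p /(mem_dgm_of gI_sorted)[_]; rewrite /wf_bar; case: (p.2) => // y [].
have wfP : {in map shift (dgm Y F k), forall p, wf_bar p}.
  move=> _ /mapP[p /(@dgm_wf _ _ _ _ _ _) + ->]; rewrite /wf_bar /=.
  by case: (p.2) => //= y; rewrite ltrD2r.
have cX s t : s <= t -> count (alive s t) (dgm X F k) = bX s t.
  by move=> st; rewrite count_dgm // /bX relrank_X.
have cP s t : s <= t -> count (alive s t) (map shift (dgm Y F k)) = bP s t.
  move=> st; rewrite /bP relrank_P // -count_dgm ?lerD2r // count_map.
  apply: eq_count => p; rewrite /alive /= lerBlDr; congr andb.
  by case: (p.2) => //= y; rewrite ltrBrDr.
have eta0 : 0 <= eta by rewrite /eta mulr_ge0.
have [||||||M [rX [rP [pX pP good badX badP]]]] :=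
  @induced_matching R eta _ DI _ bX bI bP eta0 (@dgm_wf _ F _ _ X k) wfI wfP cX cI cP.
- by move=> s' s t ss st; apply: relrank_Frobenius; [apply: ZX_mono|apply: BX_BP].
- move=> s' s t ss st; rewrite /bI -(relrank_cap (Z' := ZX s) (Z := ZX s)) //.
  rewrite -(relrank_cap (Z' := ZX s') (Z := ZX s)) ?ZX_mono //.
  apply: relrank_Frobenius; first exact: ZX_mono.
  exact: kernel_trivial.
- move=> s t' t st tt; rewrite addnC; apply: relrank_Frobenius.
    exact: ZX_ZP.
  exact: BP_mono.
- by move=> s t st; apply: relrank_leq; [apply: ZX_ZP|].
- move=> s t' t st tt.
  (* Adding boundaries that die anyway leaves the rank unchanged and makes the space large enough to
     contain [ZP s]. *)
  have eqr u : s + eta <= u ->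
      relrank (ZX (s + eta)) (BP u) = relrank (ZX (s + eta) + BP (s + eta))%MS (BP u).
    move=> su; apply: relrank_eq; first exact: (submx_trans (addsmxSl _ _) (addsmxSl _ _)).
    by rewrite addsmxS // BP_mono.
  rewrite /bI !eqr ?(le_trans st) // addnC; apply: relrank_Frobenius.
    exact: cokernel_trivial.
  exact: BP_mono.
- move=> s t st.
  have -> : bI (s + eta) t = relrank (ZX (s + eta) + BP (s + eta))%MS (BP t).
    apply: relrank_eq; first exact: (submx_trans (addsmxSl _ _) (addsmxSl _ _)).
    by rewrite addsmxS // BP_mono.
  apply: relrank_leq => //; exact: cokernel_trivial.
apply: (@bottleneck_le _ eps eps_ge0 [seq (q.1, unshift q.2) | q <- M] rX (map unshift rP)).
- by rewrite /unzip1 -map_comp.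
- have -> : dgm Y F k = map unshift (map shift (dgm Y F k)).
    by rewrite -map_comp map_id_in // => p _; apply: shiftK.
  by rewrite (permPl (perm_map unshift pP)) map_cat /unzip2 -!map_comp.
- move=> _ _ /mapP[[[x1 x2] [p1 p2]] /good[/= /andP[h1 h2]] h3 [-> ->]].
  rewrite /linf /unshift /= ge_max lee_fin; apply/andP; split.
    by rewrite ler_norml; apply/andP; move: h1 h2; rewrite /eta => *; split; lra.
  case: x2 p2 h3 => [x|] [y|] //= /andP[h3 h4]; rewrite lee_fin ler_norml.
  by apply/andP; move: h3 h4; rewrite /eta => *; split; lra.
- move=> p pr; have := badX p pr; have : p \in dgm X F k by rewrite (perm_mem pX) mem_cat pr orbT.
  by move=> /dgm_wf; rewrite /wf_bar /short; case: (p.2) => // y /ltW -> /=.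
move=> _ /mapP[p pr ->]; have := badP p pr.
have /wfP : p \in map shift (dgm Y F k) by rewrite (perm_mem pP) mem_cat pr orbT.
rewrite /wf_bar /short /=; case: (p.2) => //= y /ltW h1; rewrite /eta => h2.
by apply/andP; split; lra.
Qed.

End Interleaving.

Lemma cDR_ge1 (R : realType) k : 1 <= cDR R k.+1.
Proof.
rewrite -[leLHS]sqrtr1 ler_wsqrtr // ler_pdivlMr ?mul1r.
  by rewrite -natr1; have : 0 <= k%:R :> R by []; lra.
by rewrite ltr_wpDl.
Qed.

Lemma distortion_ge (R : realType) (d n m : nat) (X : 'I_n -> 'rV[R]_d)
    (Y : 'I_m -> 'rV[R]_d) (C : {set 'I_n * 'I_m}) p q : p \in C -> q \in C ->
  `|edist (X p.1) (X q.1) - edist (Y p.2) (Y q.2)| <= distortion X Y C.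
Proof.
by move=> pC qC; apply: (bigmax_sup p) => //; apply: (bigmax_sup q).
Qed.

Lemma correspondence_bottleneck (R : realType) (F : fieldType) (d n m : nat)
    (X : 'I_n -> 'rV[R]_d) (Y : 'I_m -> 'rV[R]_d) (k : nat)
    (C : {set 'I_n * 'I_m}) : correspondence C ->
  (bottleneck (dgm X F k) (dgm Y F k) <=
   ((cDR R k.+1 - 1) * Num.max (diam X) (diam Y) + distortion X Y C)%:E)%E.
Proof.
move=> [/choice[f fC] /choice[g gC]].
have c1 := cDR_ge1 R k; set c := cDR R k.+1 in c1 *.
set D := distortion X Y C; set M := Num.max _ _.
have D0 : 0 <= D by apply: bigmax_ge_id.
have dX : diam X <= M by rewrite le_max lexx.
have dY : diam Y <= M by rewrite le_max lexx orbT.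
have M0 : 0 <= M := le_trans (diam_of_ge0 _ _) dX.
pose eps := (c - 1) * (M / 2) + D / 2.
have mul_le a b : a <= b -> (c - 1) * (a / 2) + D / 2 <= (c - 1) * (b / 2) + D / 2.
  by move=> ab; rewrite lerD2r ler_wpM2l ?subr_ge0 // ler_pM2r.
(* A vertex of the disjoint union stands for a pair in [C]: its own point and a chosen partner. *)
pose phi (v : 'I_(n + m)) := match split v with inl i => f i | inr j => j end.
pose psi (v : 'I_(n + m)) := match split v with inl i => i | inr j => g j end.
have psi_phi v : (psi v, phi v) \in C by rewrite /psi /phi; case: (split v).
apply: le_trans (_ : (eps%:E <= _)%E).
  apply: (@interleaved_bottleneck _ F _ n m (n + m) k X Y (@lshift n m) (@rshift n m)
    psi phi _ _ _ _ (D / 2)) => //.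
  - by move=> i j /=; rewrite ltn_add2l.
  - by move=> i; rewrite /psi -[lshift m i]/(unsplit (inl i)) unsplitK.
  - by move=> j; rewrite /phi -[rshift n j]/(unsplit (inr j)) unsplitK.
  - by rewrite divr_ge0.
  - by move=> v w; rewrite mulrC divfK //; exact: (distortion_ge X Y (psi_phi v) (psi_phi w)).
  - exact: mul_le.
  - exact: mul_le.
rewrite lee_fin /eps.
have : 0 <= (c - 1) * M by rewrite mulr_ge0 // subr_ge0.
by lra.
Qed.

Theorem theorem2 (R : realType) (F : fieldType) (d n m : nat)
  (X : 'I_n -> 'rV[R]_d) (Y : 'I_m -> 'rV[R]_d) (k : nat) :
  injective X -> injective Y -> general_position X -> general_position Y ->
  (bottleneck (dgm X F k) (dgm Y F k)
     <= ((@cDR R k.+1 - 1) * Num.max (diam X) (diam Y))%:E + 2%:E * dGH X Y)%E.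
Proof.
move=> _ _ _ _.
have [[C0 corr0]|none] := pselect (exists C : {set 'I_n * 'I_m}, correspondence C);
  last first.
  (* Without correspondences exactly one cloud is empty, and the infimum over the empty set is
     +oo. *)
  rewrite /dGH (_ : [set _ | C in _]%classic = classical_sets.set0); last first.
    by apply/seteqP; split=> // x [C cC _]; case: none; exists C.
  by rewrite ereal_inf0 gt0_muley ?lte_fin // addey // leey.
(* There are finitely many correspondences, so the Gromov-Hausdorff infimum is attained. *)
pose C := [arg min_(C < C0 | `[< correspondence C >]) distortion X Y C]%O.
have [corr Cmin] : correspondence C /\
    forall C', correspondence C' -> distortion X Y C <= distortion X Y C'.
  rewrite /C; case: (Order.TotalTheory.arg_minP (P := fun C => `[< correspondence C >])
    (distortion X Y) (asboolT corr0)).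
  by move=> C1 /asboolP c1 h; split=> // C' /asboolP; apply: h.
apply: le_trans (correspondence_bottleneck F X Y k corr) _.
rewrite EFinD leeD2l //.
have : ((distortion X Y C / 2)%:E <= dGH X Y)%E.
  apply: le_ereal_inf_tmp => _ [C' corr' <-].
  by rewrite lee_fin ler_pM2r // Cmin.
move=> /(lee_wpmul2l (x := 2%:E)) h; apply: le_trans (h _); last by rewrite lee_fin.
by rewrite -EFinM mulrC divfK.
Qed.
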